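(* Let $X$ and $Y$ be Banach spaces, let $\Theta:X\to(-\infty,\infty]$ be a proper, lower semi-continuous, $p$-convex function with $p\ge 2$ (with constant $\gamma$), let $\{\alpha_n\}$ be a sequence with $\alpha_n>0$, $1\le \alpha_n/\alpha_{n+1}\le\theta$ and $\lim_{n\to\infty}\alpha_n=0$ for some constant $\theta>1$, and let $F$ satisfy conditions (a)--(d) of the context. Let $\tau>1$ and $\xi_0\ne\xi^\dagger$. If $$\left(p^*\gamma\mu+2\gamma^{\frac{p}{p-1}}\right)\|\xi_0-\xi^\dagger\|^{\frac1{p-1}}<\rho$$ and $\mathcal E:=(K_0+K_1)\|\xi_0-\xi^\dagger\|^{\frac1{p-1}}$ is sufficiently small, then $x_n^\delta\in B_\rho(x^\dagger)\cap D(F)$ and $$\|x_n^\delta-x^\dagger\|\le\left(p^*\gamma\mu+2\gamma^{\frac{p}{p-1}}\right)\|\xi_0-\xi^\dagger\|^{\frac1{p-1}},$$ $$\|T(x_n^\delta-x^\dagger)\|\le\left(3\mu+\gamma^{\frac1{p-1}}\right)\theta^{\frac1p}\|\xi_0-\xi^\dagger\|^{\frac1{p-1}}\alpha_n^{\frac1p}$$ for all $0\le n\le\hat n_\delta$. Moreover, $n_\delta\le\hat n_\delta$ for the integer $n_\delta$ defined by either Rule 1, Rule 2 or Rule 3 (see context) with $\tau>1$.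
   Context: All spaces are real; $\|\cdot\|$ denotes the norms of $X$, $Y$ and the dual norm of $X^*$; $\langle\xi,x\rangle=\xi(x)$ for $\xi\in X^*$, $x\in X$. Convexity. For a proper convex $\Theta:X\to(-\infty,\infty]$: $D(\Theta)=\{x:\Theta(x)<\infty\}$; $\partial\Theta(x)=\{\xi\in X^*:\Theta(z)-\Theta(x)-\langle\xi,z-x\rangle\ge0\ \forall z\in X\}$; $D(\partial\Theta)=\{x\in D(\Theta):\partial\Theta(x)\neq\emptyset\}$; for $\xi\in\partial\Theta(x)$ the Bregman distance is $D_\xi\Theta(z,x)=\Theta(z)-\Theta(x)-\langle\xi,z-x\rangle$. $\Theta$ is $p$-convex ($p\ge2$) if there is $C_0>0$ with $\Theta(\lambda z+(1-\lambda)x)+C_0\lambda(1-\lambda)\|z-x\|^p\le\lambda\Theta(z)+(1-\lambda)\Theta(x)$ for all $x,z\in X$, $\lambda\in(0,1)$; equivalently, there is $\gamma>0$ with $\|z-x\|\le\gamma[D_\xi\Theta(z,x)]^{1/p}$ for all $z\in X$, $x\in D(\partial\Theta)$, $\xi\in\partial\Theta(x)$. Such a constant $\gamma$ is fixed. $p^*$ is the conjugate exponent, $1/p+1/p^*=1$. Operator. $F:D(F)\subset X\to Y$ is a (nonlinear) operator, $y\in Y$, $B_\rho(x^\dagger)=\{x\in X:\|x-x^\dagger\|<\rho\}$. Conditions on $F$: (a) $D(F)$ is closed and convex in $X$ and $F(x)=y$ has a solution $x^\dagger\in D(F)\cap D(\partial\Theta)$; (b) there is $\rho>0$ such that for each $x\in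 B_\rho(x^\dagger)\cap D(F)$ there is a bounded linear operator $F'(x):X\to Y$ with $\lim_{t\searrow0}\frac{F(x+t(z-x))-F(x)}{t}=F'(x)(z-x)$ for all $z\in B_\rho(x^\dagger)\cap D(F)$; (c) $T:=F'(x^\dagger)$ satisfies $\|T\|\le\alpha_0^{1/p}/\gamma$; (d) there are constants $K_0,K_1\ge0$ with $\|[F'(z)-F'(x)]w\|\le K_0\|z-x\|\,\|F'(x)w\|+K_1\|F'(x)(z-x)\|\,\|w\|$ for all $w\in X$ and $x,z\in B_\rho(x^\dagger)\cap D(F)$. Method. $\Theta_F(x)=\Theta(x)$ if $x\in D(F)$ and $+\infty$ otherwise. Given $\xi_0\in X^*$, $x_0:=\nabla\Theta_F^*(\xi_0)$ ($\Theta_F^*$ the Fenchel conjugate), i.e. $x_0$ is the unique minimizer of $\Theta_F(x)-\langle\xi_0,x\rangle$ over $X$, so $\xi_0\in\partial\Theta_F(x_0)$. $\xi^\dagger\in\partial\Theta_F(x^\dagger)$ is the unique element of $\partial\Theta_F(x^\dagger)$ with $\|\xi_0-\xi^\dagger\|$ equal to the distance from $\xi_0$ to $\partial\Theta_F(x^\dagger)$. For $\delta>0$ and $y^\delta\in Y$ with $\|y^\delta-y\|\le\delta$, set $x_0^\delta:=x_0$ and let $x_{n+1}^\delta$ be the unique minimizer over $x\in X$ of $$\|y^\delta-F(x_n^\delta)-F'(x_n^\delta)(x-x_n^\delta)\|^p+\alpha_nD_{\xi_0}\Theta_F(x,x_0)$$ (meaningful as long as $x_n^\delta\in B_\rho(x^\dagger)\cap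 D(F)$). Stopping rules, for given $\tau>1$. Rule 1: $n_\delta$ is the integer with $\|F(x_{n_\delta}^\delta)-y^\delta\|\le\tau\delta<\|F(x_n^\delta)-y^\delta\|$ for $0\le n<n_\delta$. Rule 2: if $\|F(x_0)-y^\delta\|\le\tau\delta$ then $n_\delta=0$; otherwise $n_\delta\ge1$ is the first integer with $\frac12(\|F(x_{n_\delta}^\delta)-y^\delta\|+\|F(x_{n_\delta-1}^\delta)-y^\delta\|)\le\tau\delta$. Rule 3: if $\|F(x_0)-y^\delta\|\le\tau\delta$ then $n_\delta=0$; otherwise $n_\delta\ge2$ is the first integer with $\max\{\|F(x_{n_\delta}^\delta)-y^\delta\|,\|F(x_{n_\delta-1}^\delta)-y^\delta\|\}\le\tau\delta$. The number $\mu>0$ is fixed, chosen depending only on $p,\gamma,\theta,\tau$, so that $\gamma^{\frac1{p-1}}\theta^{\frac2p}\mu^{-1}<\frac{\tau-1}2$. The integer $\hat n_\delta\ge0$ is defined by $$\alpha_{\hat n_\delta}\le\frac{\mu^{-p}\delta^p}{\|\xi_0-\xi^\dagger\|^{p^*}}<\alpha_n,\qquad 0\le n<\hat n_\delta.$$ ''Sufficiently small'' means: smaller than a positive threshold depending only on $p,\gamma,\theta,\tau,\mu$ (not on $n$, $\delta$, $y^\delta$). *)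

(* Defs.v *)
(* MathComp-Analysis *)
From HB Require Import structures.
From mathcomp Require Import all_boot all_order all_algebra.
From mathcomp Require Import all_classical all_reals all_analysis.
Import Order.TTheory GRing.Theory Num.Theory.
Import numFieldNormedType.Exports.

Set Implicit Arguments.
Unset Strict Implicit.
Unset Printing Implicit Defensive.

Local Open Scope classical_set_scope.
Local Open Scope ring_scope.

Record bounded_linear (R : realType) (V W : normedModType R) := BoundedLinear {
  blfun :> {linear V -> W} ;
  blfun_bounded : bounded_near blfun (nbhs (0 : V)) }.

Definition dual_space (R : realType) (V : normedModType R) : Type :=
  @bounded_linear R V R^o.

(* Meaningful for bounded linear maps and their differences: otherwise the
   supremum may be taken over an unbounded set. *)
Definition opnorm (R : realType) (V W : normedModType R) (f : V -> W) : R :=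
  sup [set `|f x| | x in [set x : V | `|x| <= 1]].

Definition dual_dist (R : realType) (V : normedModType R) (xi eta : dual_space V) : R :=
  opnorm (fun x : V => xi x - eta x).

Section Convexity.
Variables (R : realType) (X : normedModType R).
Implicit Types (Th f : X -> \bar R) (x z : X) (xi : dual_space X).

Definition proper_function Th : Prop :=
  (forall x, Th x != -oo%E) /\ exists x, (Th x < +oo)%E.

Definition dom Th : set X := [set x | (Th x < +oo)%E].

Definition bregman Th xi z x : \bar R := (Th z - Th x - (xi (z - x))%:E)%E.

Definition subdiff Th x : set (dual_space X) :=
  [set xi | forall z, (0 <= bregman Th xi z x)%E].

Definition dom_subdiff Th : set X := [set x | dom Th x /\ subdiff Th x !=set0].

Definition p_convex (p : R) Th : Prop :=
  exists2 C0 : R, 0 < C0 &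
    forall x z (lambda : R), 0 < lambda < 1 ->
      (Th (lambda *: z + (1 - lambda) *: x)%R +
         (C0 * lambda * (1 - lambda) * `|z - x| `^ p)%:E
       <= lambda%:E * Th z + (1 - lambda)%:E * Th x)%E.

Definition bregman_constant (p gam : R) Th : Prop :=
  forall x z xi, dom_subdiff Th x -> subdiff Th x xi ->
    (`|z - x|%:E <= gam%:E * poweR (bregman Th xi z x) p^-1)%E.

Definition restrict_to (D : set X) Th : X -> \bar R :=
  fun x => if x \in D then Th x else +oo%E.

Definition minimizers f : set X := [set x | forall z, (f x <= f z)%E].

Definition nearest_subgradients Th x xi : set (dual_space X) :=
  [set eta | subdiff Th x eta /\
     dual_dist xi eta = inf [set dual_dist xi zeta | zeta in subdiff Th x]].

End Convexity.

Section NewtonTypeMethod.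
Variables (R : realType) (X Y : normedModType R).

(* [F] and [F'] are total; their values outside [D] play no role.  When [D]
   has empty interior the derivative is not unique, so [F'] is a choice. *)
Definition gateaux_on (F : X -> Y) (F' : X -> bounded_linear X Y)
    (D B : set X) : Prop :=
  forall x z, (B `&` D) x -> (B `&` D) z ->
    (fun t : R => t^-1 *: (F (x + t *: (z - x)) - F x)) @ 0^'+
      --> F' x (z - x).

Definition derivative_condition (F' : X -> bounded_linear X Y)
    (D B : set X) (K0 K1 : R) : Prop :=
  forall x z w, (B `&` D) x -> (B `&` D) z ->
    `|F' z w - F' x w| <=
      K0 * `|z - x| * `|F' x w| + K1 * `|F' x (z - x)| * `|w|.

Definition linearized_functional (p a : R) (ThF : X -> \bar R) (xi0 : dual_space X)
    (x0 : X) (F : X -> Y) (F' : X -> bounded_linear X Y) (yd : Y) (u : X) :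
    X -> \bar R :=
  fun x => ((`|yd - F u - F' u (x - u)| `^ p)%:E
            + a%:E * bregman ThF xi0 x x0)%E.

(* The step from [x n] to [x n.+1] is defined only while [x n] lies in
   [B `&` D]; nothing is required of the sequence once it has left that set. *)
Definition iterates (p : R) (alpha : nat -> R) (Th : X -> \bar R)
    (F : X -> Y) (F' : X -> bounded_linear X Y) (D B : set X)
    (xi0 : dual_space X) (x0 : X) (yd : Y) (x : nat -> X) : Prop :=
  x 0%N = x0 /\
  forall n, (B `&` D) (x n) ->
    minimizers (linearized_functional p (alpha n) (restrict_to D Th) xi0 x0
                  F F' yd (x n)) = [set x n.+1].

End NewtonTypeMethod.

Section StoppingRules.
Variable R : realType.
Implicit Types (r : nat -> R) (c : R) (n : nat).

(* [r] is the sequence of residuals and [c] stands for [tau * delta]. *)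

Definition first_from (m : nat) (P : nat -> Prop) n : Prop :=
  [/\ (m <= n)%N, P n & forall k, (m <= k < n)%N -> ~ P k].

Definition rule1 r c n : Prop :=
  r n <= c /\ forall k, (k < n)%N -> c < r k.

Definition rule2 r c n : Prop :=
  if r 0%N <= c then n = 0%N
  else first_from 1 (fun k => 2^-1 * (r k + r k.-1) <= c) n.

Definition rule3 r c n : Prop :=
  if r 0%N <= c then n = 0%N
  else first_from 2 (fun k => Num.max (r k) (r k.-1) <= c) n.

Definition a_priori_index (alpha : nat -> R) c n : Prop :=
  alpha n <= c /\ forall k, (k < n)%N -> c < alpha k.

End StoppingRules.

(* Main.v *)
Require Import Defs.
From HB Require Import structures.
From mathcomp Require Import all_boot all_order all_algebra.
From mathcomp Require Import all_classical all_reals all_analysis.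
From mathcomp Require Import ring lra.
Import Order.TTheory GRing.Theory Num.Theory.
Import numFieldNormedType.Exports.

Local Open Scope classical_set_scope.
Local Open Scope ring_scope.

(** The method is studied in the units [e = |xi0 - xid| `^ (p - 1)^-1] for errors
    and [e * a n] with [a n = alpha n `^ p^-1] for their images; the hypothesis on
    [nhat] says that [delta] is at most [mu * e * a n] before [nhat] and at least
    [mu * e * a n] at [nhat].

    Comparing the value of the functional at its minimizer [u = x n.+1] with its value at
    the solution [xd] and rearranging the Bregman distances gives
      [|res| `^ p + alpha n * Delta <= b `^ p + alpha n * |xi0 - xid| * |u - xd|],
    where [Delta] is the Bregman distance of [u] to [xd] for [xid], [res] is the
    linearized residual at [u] and [b] the one at [xd].  Since [Delta] dominates
    [(|u - xd| / gam) `^ p], Young's inequality turns this into bounds for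
    [|u - xd|] and [|res|] ([newton_step_bounds]).  The nonlinearity condition
    makes [b] exceed [delta], the derivative at [x n] differ from the one at
    [xd], and [|F u - yd|] differ from [|res|], by terms carrying the small factor
    [(K0 + K1) * e] only, so that the estimates propagate by induction and the
    residual at [n] is at most [delta + (g + s) * e * a n.-1] with
    [g = gam `^ (p - 1)^-1] and [s] small ([linearization_at_solution],
    [derivative_bound_step], [residual_step]).  By the choice of [mu] this is at
    most [tau * delta] at [nhat] and at its predecessor, which makes all three
    rules stop in time ([rules_stop]).

    The linearization error is bounded by a mean value inequality along segments
    ([newton_remainder]).

    The lower bound for [Delta] needs an argument: the constant [gam] is given for
    subgradients of [Th], whereas [xid] is a subgradient of its restriction to
    [D], of which there may be more ([bregman_constant_restrict]).  The bound is
    recovered from subgradients of [Th] at points close to the segment from [xd]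
    to [u].  Such points are minimizers of [Th] plus a steep multiple of the
    distance to a given point; they exist by uniform convexity and completeness
    ([p_convex_attains_min]), and carry a subgradient of [Th] by the sum rule
    ([moreau_rockafellar]), itself a consequence of the Hahn-Banach theorem
    ([hahn_banach]). *)

(** * Inequalities for real powers *)

Section PowerInequalities.
Context {R : realType}.
Implicit Types p q a b c r s t : R.

Lemma powR_le_cancel p a b : 0 < p -> 0 <= a -> 0 <= b ->
  a `^ p <= b `^ p -> a <= b.
Proof.
move=> p0 a0 b0; apply: contraTT; rewrite -!ltNge => ba.
by apply: gt0_ltr_powR.
Qed.

Lemma powRVK p a : p != 0 -> 0 <= a -> (a `^ p^-1) `^ p = a.
Proof. by move=> p0 a0; rewrite -powRrM mulVf// powRr1. Qed.

Lemma powRKV p a : p != 0 -> 0 <= a -> (a `^ p) `^ p^-1 = a.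
Proof. by move=> p0 a0; rewrite -powRrM mulfV// powRr1. Qed.

Lemma powR_superadd p a b : 1 <= p -> 0 <= a -> 0 <= b ->
  a `^ p + b `^ p <= (a + b) `^ p.
Proof.
move=> p1 a0 b0; have p0 : 0 < p by lra.
have pB0 : 0 <= p - 1 by lra.
have ab0 : 0 <= a + b by lra.
rewrite -!(@mulr_powRB1 _ _ p)// mulrDl lerD// ler_wpM2l// ge0_ler_powR//;
  by rewrite ?nnegrE ?lerDl ?lerDr.
Qed.

Lemma conjugate_exponent (p q : R) : 1 < p -> p^-1 + q^-1 = 1 -> q = p / (p - 1).
Proof.
move=> p1 pq; have p0 : p != 0 by rewrite gt_eqF//; lra.
have pB : p - 1 != 0 by rewrite subr_eq0 gt_eqF.
have iq : q^-1 = (p - 1) / p.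
  have -> : q^-1 = 1 - p^-1 by lra.
  by field.
by rewrite -[q]invrK iq invf_div.
Qed.

(** Young's inequality with the conjugate power already evaluated. *)
Lemma young_powRB1 p q c t : 1 < p -> p^-1 + q^-1 = 1 -> 0 <= c -> 0 <= t ->
  c `^ (p - 1) * t <= c `^ p / q + t `^ p / p.
Proof.
move=> p1 pq c0 t0; have p0 : 0 < p by lra.
have pB : 0 < p - 1 by lra.
have qE := conjugate_exponent _ _ p1 pq.
have q0 : 0 < q by rewrite qE divr_gt0.
have -> : c `^ p = (c `^ (p - 1)) `^ q.
  by rewrite -powRrM qE mulrC divfK// gt_eqF.
by apply: conjugate_powR => //; [exact: powR_ge0 | rewrite addrC].
Qed.

(** Young's inequality absorbs [t] from the right-hand side, and superadditivity
    of the power separates [b] from [c]. *)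
Lemma le_of_powR_le p q b c t : 1 < p -> p^-1 + q^-1 = 1 ->
  0 <= b -> 0 <= c -> 0 <= t ->
  t `^ p <= b `^ p + c `^ (p - 1) * t -> t <= q * b + c.
Proof.
move=> p1 pq b0 c0 t0 tbc; have p0 : 0 < p by lra.
have p'1 : p^-1 < 1 by rewrite invf_lt1.
have p'0 : 0 < p^-1 by rewrite invr_gt0.
have q'0 : 0 < q^-1 by lra.
have q'1 : q^-1 < 1 by lra.
have q1 : 1 < q by rewrite -invf_lt1// -invr_gt0.
have q0 : 0 < q by lra.
have Y := @young_powRB1 p q c t p1 pq c0 t0.
have tq : t `^ p <= q * b `^ p + c `^ p.
  rewrite -(ler_pM2l q'0) mulrDr mulKf ?gt_eqF// (mulrC _ (c `^ p)).
  have -> : q^-1 = 1 - p^-1 by lra.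
  rewrite [q^-1](_ : _ = 1 - p^-1) in Y; last by lra.
  rewrite mulrBl mul1r (mulrC p^-1); lra.
have qb0 : 0 <= q * b by rewrite mulr_ge0// ltW.
apply: (@powR_le_cancel p) => //; first by rewrite addr_ge0.
apply: le_trans (@powR_superadd p _ _ (ltW p1) qb0 c0).
apply: (le_trans tq); rewrite lerD2r powRM ?(ltW q0)//.
by rewrite ler_wpM2r ?powR_ge0// le1r_powR// ltW.
Qed.

(** Here [t] is the error, [d] a Bregman distance dominating its power and [r] a
    residual: by Young's inequality the linear term in [t] costs no more than
    [al * d]. *)
Lemma le_residual_of_powR_le p q al a b c t r d : 1 < p -> p^-1 + q^-1 = 1 ->
  0 <= a -> a `^ p = al -> 0 <= b -> 0 <= c -> 0 <= t -> 0 <= r ->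
  t `^ p <= d -> r `^ p + al * d <= b `^ p + al * (c `^ (p - 1) * t) ->
  r <= b + a * c.
Proof.
move=> p1 pq a0 aal b0 c0 t0 r0 td H; have p0 : 0 < p by lra.
have al0 : 0 <= al by rewrite -aal powR_ge0.
have ac0 : 0 <= a * c by rewrite mulr_ge0.
have p'1 : p^-1 < 1 by rewrite invf_lt1.
have p'0 : 0 < p^-1 by rewrite invr_gt0.
apply: (@powR_le_cancel p) => //; first by rewrite addr_ge0.
apply: le_trans (@powR_superadd p _ _ (ltW p1) b0 ac0).
rewrite powRM// aal.
have Y := @young_powRB1 p q c t p1 pq c0 t0.
have Z : c `^ (p - 1) * t <= c `^ p + d.
  apply: (le_trans Y); rewrite lerD//.
    by rewrite ler_piMr ?powR_ge0//; lra.
  by apply: le_trans td; rewrite ler_piMr ?powR_ge0//; lra.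
have := ler_wpM2l al0 Z; rewrite mulrDr; lra.
Qed.

End PowerInequalities.

(** * The Hahn-Banach theorem *)

Section HahnBanach.
Context {R : realType} {X : lmodType R}.
Implicit Types (p q : X -> R) (x y : X) (t : R).

(** Subadditive, positively homogeneous functionals; the inequality for positive
    scalars already forces equality, and [q 0 = 0], see [sublinearZ] and
    [sublinear0]. *)
Definition sublinear q : Prop :=
  (forall x y, q (x + y) <= q x + q y) /\
  (forall t x, 0 < t -> q (t *: x) <= t * q x).

Lemma sublinear0 q : sublinear q -> q 0 = 0.
Proof.
move=> [qD qZ]; have := qD 0 0; have := qZ 2^-1 0.
by rewrite scaler0 addr0 => /(_ ltac:(lra)); lra.
Qed.

Lemma sublinearZ q t x : sublinear q -> 0 <= t -> q (t *: x) = t * q x.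
Proof.
move=> sq; rewrite le_eqVlt => /predU1P[<-|t0].
  by rewrite scale0r mul0r sublinear0.
case: (sq) => _ qZ; apply/eqP; rewrite eq_le qZ//=.
rewrite -ler_pdivlMl// (le_trans _ (qZ _ _ _)) ?invr_gt0//.
by rewrite scalerA mulVf ?gt_eqF// scale1r.
Qed.

Lemma sublinear_ge q x : sublinear q -> - q (- x) <= q x.
Proof.
by move=> sq; case: (sq) => qD _; have := qD x (- x); rewrite subrr sublinear0//; lra.
Qed.

(** The pointwise infimum of a chain of sublinear functionals dominated by [p] is
    finite, being bounded below by [x |-> - p (- x)], and sublinear. *)
Lemma sublinear_inf_chain p (A : set (X -> R)) : A !=set0 ->
  (forall q, A q -> sublinear q /\ forall x, q x <= p x) ->
  (forall q r, A q -> A r ->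
    (forall x, q x <= r x) \/ (forall x, r x <= q x)) ->
  let m := fun x => inf [set q x | q in A] in
  sublinear m /\ forall q x, A q -> m x <= q x.
Proof.
move=> [q0 Aq0] Ap Atot m.
have ne x : [set q x | q in A] !=set0 by exists (q0 x), q0.
have lb x : has_lbound [set q x | q in A].
  exists (- p (- x)) => _ [q Aq <-]; have [sq qp] := Ap _ Aq.
  by apply: le_trans (sublinear_ge _ _ sq); rewrite lerN2.
have mle q x : A q -> m x <= q x by move=> Aq; apply: ge_inf => //; exists q.
split => //; split=> [x y|t x t0].
  rewrite -lerBlDr; apply: lb_le_inf => // _ [q Aq <-].
  rewrite lerBlDr -lerBlDl; apply: lb_le_inf => // _ [r Ar <-].
  rewrite lerBlDl.
  have [[[qD _] _] [[rD _] _]] := (Ap _ Aq, Ap _ Ar).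
  case: (Atot _ _ Aq Ar) => [qr|rq].
    by apply: (le_trans (mle q _ Aq)); apply: (le_trans (qD _ _)); rewrite lerD.
  by apply: (le_trans (mle r _ Ar)); apply: (le_trans (rD _ _)); rewrite lerD.
rewrite -ler_pdivrMl//; apply: lb_le_inf => // _ [q Aq <-].
have [[_ qZ] _] := Ap _ Aq.
by rewrite ler_pdivrMl//; apply: (le_trans (mle q _ Aq)); exact: qZ.
Qed.

(** Zorn's lemma for the reversed pointwise order. *)
Lemma sublinear_minimal p : sublinear p ->
  exists m, [/\ sublinear m, forall x, m x <= p x &
    forall q, sublinear q -> (forall x, q x <= m x) -> q = m].
Proof.
move=> sp.
pose S q := sublinear q /\ forall x, q x <= p x.
pose T := {q | S q}.
pose ge (s t : T) := `[< forall x, sval t x <= sval s x >].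
have [||||[m [sm mp]] mmin] := @Zorn T ge.
- by move=> t; apply/asboolP.
- move=> r s t /asboolP rs /asboolP st; apply/asboolP => x.
  exact: le_trans (st x) (rs x).
- move=> [s Ss] [t St] /asboolP /= st /asboolP /= ts.
  have ? : s = t by apply/funext => x; apply/eqP; rewrite eq_le ts st.
  by subst t; congr exist; exact: Prop_irrelevance.
- move=> A Atot; have [[s0 As0]|A0] := pselect (A !=set0); last first.
    exists (exist S p (conj sp (fun x => lexx (p x)))) => s As.
    by exfalso; apply: A0; exists s.
  have [||| sm mle] := @sublinear_inf_chain p [set sval s | s in A].
  + by exists (sval s0), s0.
  + by move=> _ [s As <-]; case: s {As}.
  + move=> _ _ [s As <-] [t At <-].
    by case: (Atot _ _ As At) => /asboolP; [right|left].
  set m := fun x => _ in sm mle.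
  have mp x : m x <= p x.
    have := mle (sval s0) x (ex_intro2 _ _ s0 As0 erefl).
    by move=> /le_trans; apply; case: (s0) => q [].
  exists (exist S m (conj sm mp)) => s As; apply/asboolP => x /=.
  by apply: mle; exists s.
exists m; split=> // q sq qm.
have Sq : S q by split=> // x; exact: le_trans (qm x) (mp x).
have := mmin (exist S q Sq); rewrite /ge /= => /(_ _)/(congr1 sval) /=; apply.
exact/asboolP.
Qed.

(** Minimality against [x |-> inf_(t >= 0) (m (x + t y) - t m y)], which is
    sublinear and at most [- m y] at [- y]. *)
Lemma sublinear_minimalN m y : sublinear m ->
  (forall q, sublinear q -> (forall x, q x <= m x) -> q = m) ->
  m (- y) = - m y.
Proof.
move=> sm mmin; case: (sm) => mD mZ.
pose S x := [set m (x + t *: y) - t * m y | t in [set t | 0 <= t]].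
have lb x : has_lbound (S x).
  exists (- m (- x)) => _ [t /= t0 <-].
  have := mD (x + t *: y) (- x); rewrite addrAC subrr add0r sublinearZ//.
  lra.
have ne x : S x !=set0 by exists (m (x + 0 *: y) - 0 * m y), 0 => /=.
pose q x := inf (S x).
have qle x t : 0 <= t -> q x <= m (x + t *: y) - t * m y.
  by move=> t0; apply: ge_inf => //; exists t.
have qm : q = m.
  apply: mmin => [|x]; last first.
    by have := qle x 0 (lexx 0); rewrite scale0r addr0 mul0r subr0.
  split=> [x z|r x r0].
    rewrite -lerBlDr; apply: lb_le_inf => // _ [s /= s0 <-].
    rewrite lerBlDr -lerBlDl; apply: lb_le_inf => // _ [t /= t0 <-].
    rewrite lerBlDl; apply: (le_trans (qle _ (s + t) _)); first exact: addr_ge0.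
    have := mD (x + s *: y) (z + t *: y).
    rewrite addrACA -scalerDl mulrDl; lra.
  rewrite -ler_pdivrMl//; apply: lb_le_inf => // _ [s /= s0 <-].
  rewrite ler_pdivrMl//; apply: (le_trans (qle _ (r * s) _)).
    by rewrite mulr_ge0// ltW.
  by rewrite -scalerA -scalerDr sublinearZ ?(ltW r0)// mulrBr mulrA.
rewrite -{1}qm; apply/eqP; rewrite eq_le; apply/andP; split; last first.
  have : lbound (S (- y)) (- m y).
    move=> _ [t /= t0 <-].
    have := mD (- y + t *: y) y; rewrite addrAC addNr add0r sublinearZ//; lra.
  exact: lb_le_inf.
have := qle (- y) 1 ler01.
by rewrite scale1r addNr sublinear0// mul1r sub0r.
Qed.

(** The Hahn-Banach theorem, in the form: a sublinear functional dominates a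
    linear one. *)
Lemma hahn_banach p : sublinear p ->
  exists f : {linear X -> R^o}, forall x, f x <= p x.
Proof.
move=> /sublinear_minimal[m [sm mp mmin]].
have mN y : m (- y) = - m y by exact: sublinear_minimalN.
have mD x y : m (x + y) = m x + m y.
  case: (sm) => mD _; apply/eqP; rewrite eq_le mD /=.
  by have := mD (- x) (- y); rewrite -opprD !mN; lra.
have mlin : linear (m : X -> R^o).
  move=> a x y; rewrite mD; congr (_ + _).
  have [a0|/ltW a0] := leP 0 a; first by rewrite sublinearZ.
  rewrite -[a *: x]opprK mN -scaleNr sublinearZ ?oppr_ge0//.
  by rewrite mulNr opprK.
pose L := GRing.isLinear.Build R X R^o *:%R m mlin.
pose f : {linear X -> R^o} := HB.pack (m : X -> R^o) L.
by exists f.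
Qed.

End HahnBanach.

(** * Subgradients of a sum at a minimizer *)

Section MoreauRockafellar.
Context {R : realType} {X : normedModType R}.

Lemma bounded_linear_of_le (f : {linear X -> R^o}) (k : R) :
  (forall x, f x <= k * `|x|) -> bounded_near f (nbhs (0 : X)).
Proof.
move=> fk; apply/linear_boundedP; near=> r => x.
have kr : k <= r by near: r; apply: nbhs_pinfty_ge; exact: num_real.
apply: (@le_trans _ _ (k * `|x|)); last exact: ler_wpM2r.
rewrite ler_norml fk andbT lerNl -linearN.
by rewrite -[X in _ <= k * X]normrN fk.
Unshelve. all: by end_near. Qed.

(** The Moreau-Rockafellar rule at a minimizer [u] of [f + N], where [f] is
    convex on [C] and [N] is convex and Lipschitz: zero is the sum of a
    subgradient [xi] of [f] and a subgradient [- xi] of [N]. *)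
Lemma moreau_rockafellar (C : set X) (f N : X -> R) (u : X) (k : R) :
  C u ->
  (forall x y l, C x -> C y -> 0 < l < 1 ->
    C (l *: x + (1 - l) *: y) /\
    f (l *: x + (1 - l) *: y) <= l * f x + (1 - l) * f y) ->
  (forall x y l, 0 < l < 1 ->
    N (l *: x + (1 - l) *: y) <= l * N x + (1 - l) * N y) ->
  (forall x y, `|N x - N y| <= k * `|x - y|) ->
  (forall x, C x -> f u + N u <= f x + N x) ->
  exists xi : dual_space X,
    (forall x, C x -> f u + xi (x - u) <= f x) /\
    (forall x, N u - xi (x - u) <= N x).
Proof.
move=> Cu cf cN Nk umin.
pose V v t a b := [/\ 0 < t, C (u + t *: a) & v = a - b].
pose val t a b := (f (u + t *: a) - f u + (N (u + t *: b) - N u)) / t.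
pose S v := [set r | exists t a b, V v t a b /\ r = val t a b].
have Nle x y : N x - N y <= k * `|x - y| by exact: le_trans (ler_norm _) (Nk x y).
have lb v : lbound (S v) (- (k * `|v|)).
  move=> _ [t [a [b [[t0 Ca ->]] ->]]]; rewrite ler_pdivlMr//.
  have := umin _ Ca; have := Nle (u + t *: a) (u + t *: b).
  rewrite opprD addrACA subrr add0r -scalerBr normrZ gtr0_norm//; lra.
have ne v : S v !=set0.
  exists (val 1 0 (- v)), 1, 0, (- v).
  by split=> //; split; rewrite ?ltr01 ?scaler0 ?addr0 ?opprK ?add0r.
(* a linear functional below [p] is below [f] (take [t = 1] and [b = 0]), and its
   opposite is below [N] (take [t = 1] and [a = 0]) *)
pose p v := inf (S v).
have ple v t a b : V v t a b -> p v <= val t a b.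
  by move=> Vv; apply: ge_inf; [exists (- (k * `|v|)); exact: lb|exists t, a, b].
have sp : sublinear p.
  split=> [v w|r v r0]; last first.
    rewrite -ler_pdivrMl//; apply: lb_le_inf => // _ [t [a [b [[t0 Ca vE] ->]]]].
    rewrite ler_pdivrMl//.
    have r0n : r != 0 by rewrite gt_eqF.
    have t0n : t != 0 by rewrite gt_eqF.
    have trr x : (t / r) *: (r *: x) = t *: x by rewrite scalerA divfK.
    apply: (le_trans (ple _ (t / r) (r *: a) (r *: b) _)).
      by split; rewrite ?divr_gt0// ?trr// vE scalerBr.
    by rewrite /val !trr invfM invrK (mulrC t^-1) mulrCA mulrA.
  rewrite -lerBlDr; apply: lb_le_inf => // _ [t [a [b [[t0 Ca vE] ->]]]].
  rewrite lerBlDr -lerBlDl; apply: lb_le_inf => // _ [s [c [d [[s0 Cc wE] ->]]]].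
  rewrite lerBlDl.
  have ts0 : 0 < t + s by rewrite addr_gt0.
  have t0n : t != 0 by rewrite gt_eqF.
  have s0n : s != 0 by rewrite gt_eqF.
  have ts0n : t + s != 0 by rewrite gt_eqF.
  (* the weight making [u + h (a + c)] a convex combination of [u + t a] and
     [u + s c] *)
  pose l := s / (t + s); pose h := t * s / (t + s).
  have h0 : 0 < h by rewrite divr_gt0 ?mulr_gt0.
  have lB : 1 - l = t / (t + s) by rewrite /l; field.
  have l01 : 0 < l < 1.
    by rewrite divr_gt0//= -subr_gt0 lB divr_gt0.
  have comb x y : u + h *: (x + y) = l *: (u + t *: x) + (1 - l) *: (u + s *: y).
    rewrite !scalerDr addrACA -scalerDl subrKC scale1r !scalerA; congr (_ + (_ + _)).
      by congr (_ *: _); rewrite /h /l; field.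
    by congr (_ *: _); rewrite lB /h; field.
  have [Cac fac] := cf _ _ _ Ca Cc l01.
  have Nbd := cN (u + t *: b) (u + s *: d) l l01.
  apply: (le_trans (ple _ h (a + c) (b + d) _)).
    by split; rewrite ?comb// vE wE opprD addrACA.
  rewrite /val !comb ler_pdivrMr//.
  have -> : ((f (u + t *: a) - f u + (N (u + t *: b) - N u)) / t +
     (f (u + s *: c) - f u + (N (u + s *: d) - N u)) / s) * h =
     l * (f (u + t *: a) - f u + (N (u + t *: b) - N u)) +
     (1 - l) * (f (u + s *: c) - f u + (N (u + s *: d) - N u)).
    by rewrite lB /l /h; field; rewrite ts0n s0n t0n.
  lra.
have [xi xip] := hahn_banach _ sp.
have xiN v : xi v <= N (u - v) - N u.
  apply: (le_trans (xip v)); apply: (le_trans (ple _ 1 0 (- v) _)).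
    by split; rewrite ?ltr01 ?scaler0 ?addr0 ?opprK ?add0r.
  by rewrite /val scaler0 addr0 subrr add0r divr1 scale1r.
have bxi : bounded_near xi (nbhs (0 : X)).
  apply: (@bounded_linear_of_le _ k) => v; apply: (le_trans (xiN v)).
  by apply: (le_trans (Nle _ _)); rewrite addrAC subrr add0r normrN.
exists (BoundedLinear bxi); split=> [x Cx|x] /=.
  rewrite -lerBrDl; apply: (le_trans (xip _)).
  have xE : u + (x - u) = x by rewrite addrC subrK.
  apply: (le_trans (ple _ 1 (x - u) 0 _)).
    by split; rewrite ?ltr01 ?scale1r ?xE ?subr0.
  by rewrite /val scale1r xE scaler0 addr0 subrr addr0 divr1.
have := xiN (- (x - u)); rewrite linearN opprK (addrC u) subrK; lra.
Qed.

End MoreauRockafellar.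

(** * Minimizers and subgradients of uniformly convex functions *)

Section RealPart.
Context {R : realType} {X : normedModType R}.
Implicit Types (Th : X -> \bar R) (x z : X) (xi : dual_space X).

Lemma bounded_linear_bound {W : normedModType R} (f : bounded_linear X W) :
  exists2 L, 0 < L & forall x, `|f x| <= L * `|x|.
Proof.
have /linear_boundedP/pinfty_ex_gt0[L L0 fL] := blfun_bounded f.
by exists L.
Qed.

Lemma proper_fineK {Th x} : proper_function Th -> dom Th x ->
  Th x = (fine (Th x))%:E.
Proof. by move=> [Thy _] xdom; rewrite fineK// fin_numElt ltNye Thy. Qed.

Lemma bregman_fine Th xi z x : proper_function Th -> dom Th z -> dom Th x ->
  bregman Th xi z x = (fine (Th z) - fine (Th x) - xi (z - x))%:E.
Proof.
by move=> pTh dz dx; rewrite /bregman (proper_fineK pTh dz) (proper_fineK pTh dx).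
Qed.

Lemma bregman_pinfty Th xi z x : proper_function Th -> ~ dom Th z -> dom Th x ->
  bregman Th xi z x = +oo%E.
Proof.
move=> pTh dz dx; rewrite /bregman (proper_fineK pTh dx).
have -> // : Th z = +oo%E.
by apply/eqP; move: dz; rewrite /dom/= -leye_eq leNgt => /negP.
Qed.

Lemma subdiffP Th xi x : proper_function Th -> dom Th x ->
  subdiff Th x xi <->
  (forall z, dom Th z -> fine (Th x) + xi (z - x) <= fine (Th z)).
Proof.
move=> pTh dx; split=> [sx z dz|H z].
  by have := sx z; rewrite bregman_fine// lee_fin -addrA -opprD subr_ge0.
have [dz|ndz] := pselect (dom Th z); last by rewrite bregman_pinfty.
by rewrite bregman_fine// lee_fin -addrA -opprD subr_ge0; exact: H.
Qed.

Lemma p_convex_fine p Th : proper_function Th -> p_convex p Th ->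
  exists2 C0 : R, 0 < C0 & forall x z l, dom Th x -> dom Th z -> 0 < l < 1 ->
    dom Th (l *: z + (1 - l) *: x) /\
    fine (Th (l *: z + (1 - l) *: x)) + C0 * l * (1 - l) * `|z - x| `^ p
      <= l * fine (Th z) + (1 - l) * fine (Th x).
Proof.
move=> pTh [C0 C00 H]; exists C0 => // x z l dx dz l01.
have := H x z l l01; set w := l *: z + _.
rewrite (proper_fineK pTh dx) (proper_fineK pTh dz) -!EFinM -EFinD => h.
have dw : dom Th w.
  by rewrite /dom/= ltNge leye_eq; apply/eqP => wy; move: h; rewrite wy.
by split=> //; move: h; rewrite (proper_fineK pTh dw) -EFinD lee_fin.
Qed.

End RealPart.

Section Minimization.
Context {R : realType} {X : completeNormedModType R}.
Implicit Types (Th : X -> \bar R) (x z u w : X).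

(** Uniform convexity makes every minimizing sequence Cauchy. *)
Lemma p_convex_attains_min {p : R} {Th} {N : X -> R} {k b : R} : 0 < p -> 0 < k ->
  proper_function Th -> lower_semicontinuous Th -> p_convex p Th ->
  (forall x y l, 0 < l < 1 ->
    N (l *: x + (1 - l) *: y) <= l * N x + (1 - l) * N y) ->
  (forall x y, `|N x - N y| <= k * `|x - y|) ->
  (forall x, dom Th x -> b <= fine (Th x) + N x) ->
  exists2 u, dom Th u & forall x, dom Th x ->
    fine (Th u) + N u <= fine (Th x) + N x.
Proof.
move=> p0 k0 pTh lscTh /(p_convex_fine _ _ pTh)[C0 C00 cTh] cN Nk Gb.
pose G x := fine (Th x) + N x.
pose E := G @` dom Th.
have [_ [xp dxp]] := pTh.
have infE : has_inf E.
  by split; [exists (G xp), xp|exists b => _ [x dx <-]; exact: Gb].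
pose m := inf E.
have mG x : dom Th x -> m <= G x.
  by move=> dx; apply: ge_inf; [exact: infE.2|exists x].
have /choice[s sP] (n : nat) : exists x, dom Th x /\ G x < m + n.+1%:R^-1.
  by have [|_ [x dx <-] Gx] := @inf_adherent _ E n.+1%:R^-1 _ infE => //; exists x.
(* the values of [G] at [x], [z] and their midpoint control [z - x] *)
have near_min x z e : dom Th x -> dom Th z -> G x < m + e -> G z < m + e ->
    `|z - x| `^ p <= 4 * e / C0.
  move=> dx dz Gx Gz; have h : 0 < (2^-1 : R) < 1 by lra.
  have [dw cw] := cTh _ _ _ dx dz h; have := cN z x _ h; have := mG _ dw.
  move: Gx Gz cw; rewrite /G; set Z := `|z - x| `^ p.
  rewrite ler_pdivlMr//.
  have -> : C0 * 2^-1 * (1 - 2^-1) * Z = 4^-1 * (Z * C0) by field.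
  lra.
have cs : cvg (s @ \oo).
  apply/cauchy_cvgP; apply: cauchy_exP => e e0.
  pose ep := C0 * e `^ p / 8.
  have ep0 : 0 < ep by rewrite /ep divr_gt0// mulr_gt0// powR_gt0.
  have [n _ nep] := near_infty_natSinv_lt (PosNum ep0).
  exists (s n) => /=; exists n => // j /= nj.
  rewrite -ball_normE /=.
  have [dn Gn] := sP n; have [dj Gj] := sP j.
  rewrite ltNge; apply/negP => ele.
  have := near_min _ _ ep dj dn.
  have nn := nep n (leqnn n); have nj' := nep j nj; rewrite /= in nn nj'.
  have Gj' : G (s j) < m + ep by apply: (lt_trans Gj); rewrite ltrD2l.
  have Gn' : G (s n) < m + ep by apply: (lt_trans Gn); rewrite ltrD2l.
  move=> /(_ Gj' Gn').
  apply/negP; rewrite -ltNge.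
  apply: (@lt_le_trans _ _ (e `^ p)); last first.
    by apply: ge0_ler_powR; rewrite ?nnegrE ?(ltW p0) ?(ltW e0).
  have -> : 4 * ep / C0 = e `^ p / 2 by rewrite /ep; field; rewrite gt_eqF.
  by have := powR_gt0 p e0; lra.
set u := lim (s @ \oo) in cs.
(* lower semicontinuity, tested against real numbers below [Th u]; this also
   excludes that [Th u] is infinite *)
have key a : (a%:E < Th u)%E -> a + N u <= m.
  move=> /lscTh[V Vu aV]; apply/ler_addgt0Pr => e e0.
  have e20 : 0 < e / 2 by lra.
  have ek0 : 0 < e / 2 / k by rewrite divr_gt0.
  near \oo => j.
  have [dj Gj] := sP j.
  have Vj : V (s j) by near: j; exact: cs.
  have := aV _ Vj; rewrite (proper_fineK pTh dj) lte_fin => aj.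
  have dist : `|u - s j| < e / 2 / k.
    by near: j; move/cvgrPdist_lt : cs; exact.
  have je : j.+1%:R^-1 < e / 2.
    by near: j; exact: (near_infty_natSinv_lt (PosNum e20)).
  have : `|N u - N (s j)| <= e / 2.
    apply: (le_trans (Nk _ _)); rewrite mulrC -ler_pdivlMr//; exact: ltW.
  have : G (s j) < m + e / 2 by apply: (lt_trans Gj); rewrite ltrD2l.
  rewrite /G ler_norml => ? /andP[? ?]; lra.
have du : dom Th u.
  rewrite /dom/= ltNge leye_eq; apply/eqP => uy.
  have := key (m - N u + 1); rewrite uy ltry => /(_ isT); lra.
exists u => // x dx; apply: le_trans (mG x dx).
apply/ler_addgt0Pr => e e0; have := key (fine (Th u) - e).
rewrite [X in (_ < X)%E](proper_fineK pTh du) lte_fin ltrBlDr ltrDl.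
move=> /(_ e0); lra.
Unshelve. all: by end_near. Qed.

(** Near every point [w] of the domain there are subgradients, at points [u]
    where the function is almost as large as at [w]; the last inequality comes
    from the penalty [k * `|_ - w|] whose minimization produces [u]. *)
Lemma subdiff_dense {p : R} {Th} {xd w : X} {e : R} : 0 < p ->
  proper_function Th -> lower_semicontinuous Th -> p_convex p Th ->
  dom_subdiff Th xd -> dom Th w -> 0 < e ->
  exists u (xi : dual_space X), [/\ dom Th u, subdiff Th u xi, `|u - w| <= e,
    fine (Th w) - e <= fine (Th u) & 0 <= xi (w - u)].
Proof.
move=> p0 pTh lscTh cTh [dxd [ze zeP]] dw e0.
have [L L0 zeL] := bounded_linear_bound ze.
have [V Vw wV] : exists2 V, nbhs w V &
    forall y, V y -> ((fine (Th w) - e)%:E < Th y)%E.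
  by apply: lscTh; rewrite (proper_fineK pTh dw) lte_fin gtrBl.
have [r0 /= r00 rV] := (nbhs_ballP _ _).1 Vw.
pose r := Num.min r0 e.
have r_gt0 : 0 < r by rewrite lt_min r00.
pose c := fine (Th xd) - L * `|w - xd|.
pose k := L + 1 + `|fine (Th w) - c| / r.
have Kr : 0 <= `|fine (Th w) - c| / r by rewrite divr_ge0// ltW.
have k0 : 0 < k by rewrite /k; lra.
pose N x := k * `|x - w|.
(* the subgradient at [xd] bounds the penalized function from below, for it is
   [L]-Lipschitz and [L < k] *)
have lower x : dom Th x -> c + (k - L) * `|x - w| <= fine (Th x) + N x.
  move=> dx; have := (subdiffP _ _ _ pTh dxd).1 zeP x dx.
  have := zeL (x - xd); rewrite ler_norml => /andP[+ _].
  have : L * `|x - xd| <= L * `|x - w| + L * `|w - xd|.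
    by rewrite -mulrDr ler_pM2l// (le_trans _ (ler_normD _ _))// addrA subrK.
  rewrite /c /N; lra.
have cN x y l : 0 < l < 1 -> N (l *: x + (1 - l) *: y) <= l * N x + (1 - l) * N y.
  move=> /andP[l0 l1]; rewrite /N !(mulrCA _ k) -mulrDr ler_pM2l//.
  have -> : l *: x + (1 - l) *: y - w = l *: (x - w) + (1 - l) *: (y - w).
    rewrite !scalerBr addrACA -opprD -scalerDl.
    by rewrite (addrC l) subrK scale1r.
  apply: (le_trans (ler_normD _ _)); rewrite !normrZ !gtr0_norm//; lra.
have Nk x y : `|N x - N y| <= k * `|x - y|.
  rewrite /N -mulrBr normrM gtr0_norm// ler_pM2l//.
  have -> : x - y = (x - w) - (y - w) by rewrite opprB addrA subrK.
  exact: ler_dist_dist.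
have [|u du umin] := p_convex_attains_min (b := c) p0 k0 pTh lscTh cTh cN Nk.
  move=> x dx; apply: le_trans (lower x dx); rewrite lerDl mulr_ge0// /k; lra.
have [C0 C00 cTh'] := p_convex_fine _ _ pTh cTh.
have [|xi [xiTh xiN]] :=
  @moreau_rockafellar _ _ (dom Th) (fine \o Th) N u k du _ cN Nk umin.
  move=> x y l dx dy l01; have [dxy cxy] := cTh' _ _ _ dy dx l01.
  split=> //=; apply: le_trans cxy; rewrite lerDl mulr_ge0 ?powR_ge0//.
  by rewrite !mulr_ge0 ?(ltW C00)//; lra.
have uw : `|u - w| < r.
  have := lower u du; have := umin w dw; rewrite {2}/N subrr normr0 mulr0 addr0.
  move=> h1 h2; have : (k - L) * `|u - w| < (k - L) * r.
    apply: (@le_lt_trans _ _ (fine (Th w) - c)); first by lra.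
    rewrite /k [X in X * r](_ : _ = 1 + `|fine (Th w) - c| / r); last by ring.
    rewrite mulrDl mul1r divfK ?gt_eqF//.
    by have := ler_norm (fine (Th w) - c); lra.
  by rewrite ltr_pM2l// /k; lra.
exists u, xi; split => //.
- by apply/subdiffP.
- by apply: (le_trans (ltW uw)); rewrite /r ge_min lexx orbT.
- have Vu : V u.
    apply: rV; rewrite -ball_normE /= distrC.
    by apply: (lt_le_trans uw); rewrite /r ge_min lexx.
  by have := wV _ Vu; rewrite (proper_fineK pTh du) lte_fin; exact: ltW.
- have := xiN w; rewrite {2}/N subrr normr0 mulr0 /N => h.
  have : 0 <= k * `|u - w| by rewrite mulr_ge0// ltW.
  lra.
Qed.

End Minimization.

(** * The Bregman distance of the restriction to a convex set *)

Section Restriction.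
Context {R : realType} {X : completeNormedModType R}.
Implicit Types (Th : X -> \bar R) (D : set X) (x z u w : X).

Lemma dom_restrict D Th : dom (restrict_to D Th) = D `&` dom Th.
Proof.
apply/seteqP; split=> x; rewrite /dom /restrict_to /=; case: ifPn => [/set_mem Dx|].
- by move=> dx; split.
- by rewrite ltxx.
- by case.
- by move=> /negP xD [Dx]; exfalso; apply: xD; exact/mem_set.
Qed.

Lemma proper_restrict D Th x : proper_function Th -> D x -> dom Th x ->
  proper_function (restrict_to D Th).
Proof.
move=> [Thy _] Dx dx; split; first by move=> z; rewrite /restrict_to; case: ifP.
by exists x; have : dom (restrict_to D Th) x by rewrite dom_restrict.
Qed.

Lemma restrictE D Th x : D x -> restrict_to D Th x = Th x.
Proof. by move=> Dx; rewrite /restrict_to mem_set. Qed.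

Lemma bregman_constant_fine (p gam : R) Th x z (xi : dual_space X) : 0 < p -> 0 < gam ->
  proper_function Th -> bregman_constant p gam Th -> dom Th x -> dom Th z ->
  subdiff Th x xi ->
  (`|z - x| / gam) `^ p <= fine (Th z) - fine (Th x) - xi (z - x).
Proof.
move=> p0 gam0 pTh H dx dz sx.
have := H x z xi (conj dx (ex_intro _ xi sx)) sx.
have B0 := (subdiffP _ _ _ pTh dx).1 sx z dz.
rewrite bregman_fine// poweR_EFin -EFinM lee_fin => h.
set B := fine (Th z) - fine (Th x) - xi (z - x) in h *.
have B0' : 0 <= B by rewrite /B; lra.
rewrite -[B in leRHS](@powRVK _ p)// ?gt_eqF//.
apply: ge0_ler_powR; rewrite ?nnegrE ?(ltW p0) ?powR_ge0//.
  by rewrite divr_ge0// ltW.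
by rewrite ler_pdivrMr// mulrC.
Qed.

(** Restricting [Th] to a convex set preserves the constant in the lower bound
    for the Bregman distance, although it enlarges the subdifferential.  The
    bound holds for subgradients of [Th] at points [u] near
    [w = lam z + (1 - lam) x]; there
      [lam Th z + (1 - lam) Th x >= Th w + lam (|z - u| / gam) `^ p]
    up to an error that is quadratic in [lam].  As [w] lies in [D], the
    subgradient [xi] of the restriction bounds [Th w] from below; dividing by
    [lam] and letting it tend to zero gives the bound for [xi]. *)
Lemma bregman_constant_restrict (p gam : R) Th D x z (xi : dual_space X) :
  0 < p -> 0 < gam -> proper_function Th -> lower_semicontinuous Th ->
  p_convex p Th -> bregman_constant p gam Th -> @convex_set R X D ->
  D x -> dom_subdiff Th x -> subdiff (restrict_to D Th) x xi ->
  D z -> dom Th z ->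
  (`|z - x| / gam) `^ p <= fine (Th z) - fine (Th x) - xi (z - x).
Proof.
move=> p0 gam0 pTh lscTh cTh bTh cD Dx dsx sx Dz dz.
have dx : dom Th x := dsx.1.
have pThD := proper_restrict _ _ _ pTh Dx dx.
have dDx : dom (restrict_to D Th) x by rewrite dom_restrict.
have xiP w : D w -> dom Th w -> fine (Th x) + xi (w - x) <= fine (Th w).
  move=> Dw dw; have := (subdiffP _ _ _ pThD dDx).1 sx w.
  by rewrite dom_restrict !restrictE//; apply; split.
set S := `|z - x|; set B := fine (Th z) - fine (Th x) - xi (z - x).
have B0 : 0 <= B by have := xiP z Dz dz; rewrite /B; lra.
have [C0 C00 cTh'] := p_convex_fine _ _ pTh cTh.
(* the bound at the point [w] of parameter [lam], with [lam ^+ 2] as the distance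
   allowed between [w] and [u] *)
have key lam : 0 < lam < 1 -> lam ^+ 2 <= (1 - lam) * S ->
    (((1 - lam) * S - lam ^+ 2) / gam) `^ p <= B + lam.
  move=> l01 lS; have /andP[l0 l1] := l01.
  set w := lam *: z + (1 - lam) *: x.
  have wx : w - x = lam *: (z - x).
    by rewrite /w scalerBl scale1r scalerBr; rewrite -addrA addrAC subrr add0r.
  have zw : z - w = (1 - lam) *: (z - x).
    have -> : z - w = (z - x) - (w - x) by rewrite opprB addrA subrK.
    by rewrite wx scalerBl scale1r.
  have [dw _] := cTh' _ _ _ dx dz l01; rewrite -/w in dw.
  have Dw : D w.
    have := cD z x (Itv01 (ltW l0) (ltW l1)) (mem_set Dz) (mem_set Dx).
    by move/set_mem.
  have l20 : 0 < lam ^+ 2 by rewrite exprn_gt0.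
  have [u [ze [du su uw Thu zewu]]] := subdiff_dense p0 pTh lscTh cTh dsx dw l20.
  have := bregman_constant_fine _ _ _ _ _ _ p0 gam0 pTh bTh du dz su.
  have zex := (subdiffP _ _ _ pTh du).1 su x dx.
  have Thw := xiP w Dw dw; rewrite wx linearZ/= in Thw.
  have zuS : (1 - lam) * S - lam ^+ 2 <= `|z - u|.
    have : `|z - w| <= `|z - u| + `|u - w|.
      by apply: le_trans (ler_normD _ _); rewrite addrA subrK.
    rewrite zw normrZ gtr0_norm ?subr_gt0//; rewrite -/S; lra.
  have pow_le : (((1 - lam) * S - lam ^+ 2) / gam) `^ p <= (`|z - u| / gam) `^ p.
    apply: ge0_ler_powR; rewrite ?nnegrE ?(ltW p0)// ?divr_ge0 ?subr_ge0 ?(ltW gam0)//.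
    by rewrite ler_pM2r ?invr_gt0.
  move=> /(le_trans pow_le) main; apply: (le_trans main).
  have wE : w - u = lam *: (z - u) + (1 - lam) *: (x - u).
    by rewrite !scalerBr addrACA -opprD -scalerDl (addrC lam) subrK scale1r.
  move: zewu; rewrite wE linearD !linearZ/= => zewu.
  rewrite -(ler_pM2l l0) /B.
  have : (1 - lam) * (fine (Th u) + ze (x - u)) <= (1 - lam) * fine (Th x).
    by rewrite ler_pM2l ?subr_gt0.
  rewrite /GRing.scale/= in zewu Thw; nra.
rewrite leNgt; apply/negP => BS.
pose b := gam * B `^ p^-1.
have b0 : 0 <= b by rewrite mulr_ge0 ?powR_ge0// ltW.
have bB : (b / gam) `^ p = B by rewrite /b mulrAC mulfV ?gt_eqF// mul1r powRVK ?gt_eqF.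
have S0 : 0 <= S by rewrite /S.
have bS : b < S.
  rewrite ltNge; apply/negP => Sb; move: BS; apply/negP; rewrite -leNgt -bB.
  apply: ge0_ler_powR; rewrite ?nnegrE ?(ltW p0)// ?divr_ge0// ?(ltW gam0)//.
  by rewrite ler_pM2r ?invr_gt0.
(* [b] solves [(b / gam) `^ p = B]; any [S'] strictly between [b] and [S] gives a
   contradiction once [lam] is small *)
pose S' := (b + S) / 2.
pose B' := (S' / gam) `^ p.
have BB' : B < B'.
  rewrite -bB; apply: gt0_ltr_powR => //; rewrite ?nnegrE ?divr_ge0 ?(ltW gam0)//.
    by rewrite /S'; lra.
  by rewrite ltr_pM2r ?invr_gt0// /S'; lra.
have Sp : 0 < S + 1 by lra.
pose lam := Num.min (2^-1) (Num.min ((B' - B) / 2) ((S - S') / (S + 1))).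
have S'S : 0 < S - S' by rewrite /S'; lra.
have l0 : 0 < lam by rewrite !lt_min !divr_gt0 ?subr_gt0 ?invr_gt0 ?ltr0n//; lra.
have l1 : lam <= 2^-1 by rewrite ge_min lexx.
have lB : lam <= (B' - B) / 2 by rewrite !ge_min lexx !orbT.
have lS : lam * (S + 1) <= S - S'.
  by rewrite -ler_pdivlMr// !ge_min lexx !orbT.
have S'le : S' <= (1 - lam) * S - lam ^+ 2 by nra.
have S'0 : 0 <= S' by rewrite /S'; lra.
have := key lam; rewrite l0 -subr_ge0 => /(_ ltac:(lra) (le_trans S'0 S'le)).
suff : B' <= (((1 - lam) * S - lam ^+ 2) / gam) `^ p by lra.
apply: ge0_ler_powR; rewrite ?nnegrE ?(ltW p0)// ?divr_ge0// ?(ltW gam0)//.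
- exact: addr_ge0.
- exact: le_trans S'0 S'le.
- by rewrite ler_pM2r ?invr_gt0.
Qed.

End Restriction.

(** * The linearization error *)

Section TaylorRemainder.
Context {R : realType}.

(** A mean value inequality for curves in a normed space, without any
    integration: the supremum of the times up to which the bound holds is [1]. *)
Lemma mean_value_norm {Y : normedModType R} (Phi : R -> Y) (C : R) :
  0 <= C ->
  (forall t e, 0 <= t <= 1 -> 0 < e -> exists2 d, 0 < d &
    forall s, 0 <= s <= 1 -> `|s - t| < d ->
      `|Phi s - Phi t| <= (C + e) * `|s - t|) ->
  `|Phi 1 - Phi 0| <= C.
Proof.
move=> C0 loc; apply/ler_addgt0Pr => e e0.
pose A := [set s | 0 <= s <= 1 /\ `|Phi s - Phi 0| <= (C + e) * s].
have Ce : 0 < C + e by rewrite ltr_wpDl.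
have A0 : A 0 by rewrite /A/= subrr normr0 mulr0 !lexx ler01.
have supA : has_sup A by split; [exists 0|exists 1 => s [/andP[]]].
pose t := sup A.
have t0 : 0 <= t by apply: sup_upper_bound.
have t1 : t <= 1 by apply: ge_sup; [exists 0|move=> s [/andP[]]].
have t01 : 0 <= t <= 1 by rewrite t0.
have [d d0 dP] := loc t e t01 e0.
have step s r : `|Phi s - Phi 0| <= (C + e) * s -> s <= r ->
    `|Phi r - Phi s| <= (C + e) * `|r - s| -> `|Phi r - Phi 0| <= (C + e) * r.
  move=> h1 sr; rewrite ger0_norm ?subr_ge0// => h2.
  rewrite -(subrKA (Phi s)) (le_trans (ler_normD _ _))//; lra.
have At : `|Phi t - Phi 0| <= (C + e) * t.
  have [s As ts] := sup_adherent d0 supA.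
  have st : s <= t by exact: sup_upper_bound.
  case: As => s01 hs; apply: (step s) => //.
  rewrite distrC [`|t - s|]distrC; apply: dP => //.
  by rewrite distrC ger0_norm ?subr_ge0// ltrBlDr addrC -ltrBlDr.
have [t_lt1|t_ge1] := ltP t 1; last first.
  by have <- : t = 1 by [apply/eqP; rewrite eq_le t1]; rewrite -[leRHS]mulr1;
     apply: le_trans At _; rewrite ler_pM2l.
pose s := Num.min 1 (t + d / 2).
have ts : t < s by rewrite lt_min t_lt1 ltrDl divr_gt0.
have s1 : s <= 1 by rewrite ge_min lexx.
have sd : s <= t + d / 2 by rewrite ge_min lexx orbT.
have : A s.
  split; first by rewrite s1 andbT (le_trans t0)// ltW.
  apply: (step t) => //; first exact: ltW.
  apply: dP; first by rewrite s1 andbT (le_trans t0)// ltW.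
  by rewrite gtr0_norm ?subr_gt0//; lra.
by move=> /(sup_upper_bound supA); rewrite -/t leNgt ts.
Qed.

Context {X Y : normedModType R}.
Variables (F : X -> Y) (F' : X -> bounded_linear X Y) (D B : set X).

Lemma gateaux_on_small a b (e : R) : gateaux_on F F' D B ->
  (B `&` D) a -> (B `&` D) b -> 0 < e ->
  exists2 d, 0 < d & forall s, 0 < s < d ->
    `|F (a + s *: (b - a)) - F a - s *: F' a (b - a)| <= e * s.
Proof.
move=> gF aD bD e0; have /cvgrPdist_le/(_ _ e0) := gF a b aD bD.
move=> [d /= d0 dP]; exists d => // s /andP[s0 sd].
have := dP s; rewrite /= sub0r normrN gtr0_norm// => /(_ sd s0).
set q := F _ - F a => h.
have -> : q - s *: F' a (b - a) = s *: (s^-1 *: q - F' a (b - a)).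
  by rewrite scalerBr scalerA mulfV ?gt_eqF// scale1r.
by rewrite normrZ gtr0_norm// mulrC ler_pM2r// distrC.
Qed.

(** The one-sided directional derivatives at the points of the segment, towards
    both of its ends, are all that the mean value inequality needs. *)
Lemma gateaux_remainder (x z : X) (v : Y) (C : R) : gateaux_on F F' D B ->
  (forall t, 0 <= t <= 1 -> (B `&` D) (x + t *: (z - x))) -> 0 <= C ->
  (forall t, 0 <= t <= 1 -> `|F' (x + t *: (z - x)) (z - x) - v| <= C) ->
  `|F z - F x - v| <= C.
Proof.
move=> gF seg C0 F'C; set h := z - x in seg F'C *.
pose g t := x + t *: h.
pose Phi t := F (g t) - t *: v.
have -> : F z - F x - v = Phi 1 - Phi 0.
  by rewrite /Phi /g !scale1r !scale0r addr0 subr0 {1}/h (addrC x) subrK addrAC.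
apply: mean_value_norm => // t e t01 e0.
(* the one-sided derivative of [F \o g] at [t], in the direction of the
   endpoint [g T] of the segment, [T = 0, 1] *)
have side T : 0 <= T <= 1 -> exists2 d, 0 < d & forall s,
    0 < (s - t) / (T - t) -> `|s - t| < d ->
    `|F (g s) - F (g t) - (s - t) *: F' (g t) h| <= e * `|s - t|.
  move=> T01; have [->|Tt] := eqVneq T t.
    by exists 1 => // s; rewrite subrr invr0 mulr0 ltxx.
  have Tt0 : T - t != 0 by rewrite subr_eq0.
  have nTt0 : 0 < `|T - t| by rewrite normr_gt0.
  have eT' : 0 < e * `|T - t| by rewrite mulr_gt0.
  have [d d0 dP] := gateaux_on_small _ _ _ gF (seg t t01) (seg T T01) eT'.
  exists (d * `|T - t|); first by rewrite mulr_gt0.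
  move=> s r0 sd; set r := (s - t) / (T - t) in r0.
  have rT : r * (T - t) = s - t by rewrite /r divfK.
  have rn : r * `|T - t| = `|s - t| by rewrite -rT normrM (gtr0_norm r0).
  have gTt : g T - g t = (T - t) *: h.
    by rewrite /g opprD addrACA subrr add0r scalerBl.
  have := dP r; rewrite r0 -(ltr_pM2r nTt0) rn sd => /(_ isT).
  rewrite -/(g t) -/(g T) gTt scalerA rT [F' (g t) _]linearZ/= scalerA rT.
  have -> : g t + (s - t) *: h = g s by rewrite /g -addrA -scalerDl subrKC.
  by rewrite -mulrA (mulrC _ r) rn.
have [d0 d00 dP0] := side 0 ltac:(by rewrite lexx ler01).
have [d1 d10 dP1] := side 1 ltac:(by rewrite lexx ler01).
exists (Num.min d0 d1) => [|s s01]; first by rewrite lt_min d00.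
rewrite lt_min => /andP[sd0 sd1].
have [->|st] := eqVneq s t; first by rewrite !subrr !normr0 mulr0.
have main : `|F (g s) - F (g t) - (s - t) *: F' (g t) h| <= e * `|s - t|.
  move: t01 s01 => /andP[t0 t1] /andP[s0 s1].
  case: (ltgtP s t) => [lst|lts|eq_st]; last by rewrite eq_st eqxx in st.
    apply: dP0 => //; rewrite -mulrNN -invrN divr_gt0// ?opprB ?subr0 ?subr_gt0//.
    by rewrite (le_lt_trans s0).
  by apply: dP1 => //; rewrite divr_gt0// subr_gt0// (lt_le_trans lts).
have -> : Phi s - Phi t = (F (g s) - F (g t) - (s - t) *: F' (g t) h) +
    (s - t) *: (F' (g t) h - v).
  rewrite /Phi scalerBr addrA subrK scalerBl !opprB.
  by rewrite (addrC (t *: v) (- F _)) addrACA (addrC (- (s *: v))).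
apply: (le_trans (ler_normD _ _)); rewrite normrZ.
have := F'C t t01; rewrite -/(g t) => h1.
have := ler_wpM2l (normr_ge0 (s - t)) h1; lra.
Qed.

(** The nonlinearity condition, applied along the segment from [x] to [z], bounds
    the linearization error by the size of the linear term itself. *)
Lemma newton_remainder (K0 K1 : R) (x z : X) : gateaux_on F F' D B ->
  derivative_condition F' D B K0 K1 -> 0 <= K0 -> 0 <= K1 ->
  (forall t, 0 <= t <= 1 -> (B `&` D) (x + t *: (z - x))) ->
  `|F z - F x - F' x (z - x)| <= (K0 + K1) * `|z - x| * `|F' x (z - x)|.
Proof.
move=> gF dF K00 K10 seg.
have xD : (B `&` D) x.
  by have := seg 0; rewrite scale0r addr0; apply; rewrite lexx ler01.
apply: gateaux_remainder => // [|t t01].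
  by rewrite !mulr_ge0// addr_ge0.
apply: (le_trans (dF _ _ _ xD (seg t t01))).
rewrite addrAC subrr add0r linearZ/= !normrZ.
have t1 : `|t| <= 1 by case/andP: t01 => t0 t1; rewrite ger0_norm.
set a := `|z - x|; set b := `|F' x _|.
have ab0 : 0 <= a * b by rewrite /a /b mulr_ge0.
have := ler_wpM2r (mulr_ge0 K00 ab0) t1; have := ler_wpM2r (mulr_ge0 K10 ab0) t1.
lra.
Qed.

End TaylorRemainder.

(** * One minimization step *)

Section OperatorNorm.
Context {R : realType} {X : normedModType R}.

(** Stated for homogeneous functions, which covers bounded linear maps as well as
    differences of functionals. *)
Lemma opnorm_bounds {W : normedModType R} (f : X -> W) (L : R) :
  (forall c x, f (c *: x) = c *: f x) -> (forall x, `|f x| <= L * `|x|) ->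
  0 <= opnorm f /\ forall x, `|f x| <= opnorm f * `|x|.
Proof.
move=> fZ fL.
have f0 : f 0 = 0 by rewrite -(scale0r 0) fZ scale0r.
set A := [set `|f x| | x in [set x : X | `|x| <= 1]].
have ubA : has_ubound A.
  exists `|L| => _ [x /= x1 <-]; apply: (le_trans (fL x)).
  rewrite (le_trans (ler_wpM2r _ (ler_norm L)))// -[leRHS]mulr1.
  exact: ler_wpM2l.
have Aop x : A x -> x <= opnorm f by move=> Ax; apply: ub_le_sup.
split; first by apply: Aop; exists 0; rewrite /= ?normr0 ?f0 ?normr0.
move=> x; have [->|x0] := eqVneq x 0; first by rewrite f0 !normr0 mulr0.
have nx0 : 0 < `|x| by rewrite normr_gt0.
rewrite -ler_pdivrMr//; apply: Aop; exists (`|x|^-1 *: x).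
  by rewrite /= normrZ normfV normr_id mulVf ?gt_eqF.
by rewrite fZ normrZ normfV normr_id mulrC.
Qed.

Lemma le_opnorm {W : normedModType R} (f : bounded_linear X W) x :
  `|f x| <= opnorm f * `|x|.
Proof.
have [L _ fL] := bounded_linear_bound f.
by have [_] := @opnorm_bounds W f L (fun c x => linearZ _ _) fL; apply.
Qed.

Lemma opnorm_ge0 {W : normedModType R} (f : bounded_linear X W) : 0 <= opnorm f.
Proof.
have [L _ fL] := bounded_linear_bound f.
by have [] := @opnorm_bounds W f L (fun c x => linearZ _ _) fL.
Qed.

Lemma dual_dist_bounds (xi eta : dual_space X) : 0 <= dual_dist xi eta /\
  forall x, `|xi x - eta x| <= dual_dist xi eta * `|x|.
Proof.
have [L _ xiL] := bounded_linear_bound xi.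
have [K _ etaK] := bounded_linear_bound eta.
apply: (@opnorm_bounds R^o (fun x => xi x - eta x) (L + K)) => [c x|x].
  by rewrite scalerBr; congr (_ - _); rewrite linearZ.
by rewrite mulrDl (le_trans (ler_normB _ _))// lerD.
Qed.

End OperatorNorm.

Lemma segment_ball_convex {R : realType} {X : normedModType R} (D : set X)
    (c x z : X) (rho t : R) : @convex_set R X D ->
  (ball c rho `&` D) x -> (ball c rho `&` D) z -> 0 <= t <= 1 ->
  (ball c rho `&` D) (x + t *: (z - x)).
Proof.
move=> cD [Bx Dx] [Bz Dz] /andP[t0 t1].
have -> : x + t *: (z - x) = t *: z + (1 - t) *: x.
  by rewrite scalerBr scalerBl scale1r addrCA.
split; last first.
  by have := cD z x (Itv01 t0 t1) (mem_set Dz) (mem_set Dx) => /set_mem.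
move: Bx Bz; rewrite -!ball_normE /= => Bx Bz.
have -> : c - (t *: z + (1 - t) *: x) = t *: (c - z) + (1 - t) *: (c - x).
  by rewrite !scalerBr addrACA -scalerDl (addrC t) subrK scale1r opprD.
pose m := Num.max `|c - z| `|c - x|.
have mrho : m < rho by rewrite gt_max Bz.
apply: le_lt_trans mrho; apply: (le_trans (ler_normD _ _)).
rewrite !normrZ !ger0_norm ?subr_ge0//.
have zm : `|c - z| <= m by rewrite le_max lexx.
have xm : `|c - x| <= m by rewrite le_max lexx orbT.
have := ler_wpM2l t0 zm; have := @ler_wpM2l _ (1 - t) ltac:(by rewrite subr_ge0) _ _ xm.
lra.
Qed.

Section NewtonStep.
Context {R : realType} {X Y : completeNormedModType R}.
Variables (p q gam : R) (Th : X -> \bar R) (D : set X) (xd x0 : X).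
Variables (xi0 xid : dual_space X).
Hypotheses (p1 : 1 < p) (pq : p^-1 + q^-1 = 1) (gam0 : 0 < gam).
Hypotheses (pTh : proper_function Th) (lscTh : lower_semicontinuous Th).
Hypotheses (cTh : p_convex p Th) (bTh : bregman_constant p gam Th).
Hypotheses (cD : @convex_set R X D) (Dxd : D xd) (dxd : dom_subdiff Th xd).
Hypothesis sxid : subdiff (restrict_to D Th) xd xid.
Hypothesis x0min :
  minimizers (fun x => restrict_to D Th x - (xi0 x)%:E)%E x0.

Let d := dual_dist xi0 xid.
Let g := gam `^ (p - 1)^-1.
Let e := d `^ (p - 1)^-1.
Let pThD : proper_function (restrict_to D Th).
Proof. exact: (proper_restrict _ _ _ pTh Dxd dxd.1). Qed.
Let dDxd : dom (restrict_to D Th) xd.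
Proof. by rewrite dom_restrict; split=> //; case: dxd. Qed.

Lemma dom_start : dom (restrict_to D Th) x0.
Proof.
have := x0min xd; rewrite (proper_fineK pThD dDxd) -EFinB => h.
rewrite /dom/= ltNge leye_eq; apply/eqP => y0.
by move: h; rewrite y0.
Qed.

Let xi_le z : xi0 (z - xd) - xid (z - xd) <= (g * e) `^ (p - 1) * (`|z - xd| / gam).
Proof.
have [d0 dP] := dual_dist_bounds xi0 xid.
have pB0 : p - 1 != 0 by rewrite subr_eq0 gt_eqF.
apply: (le_trans (ler_norm _)); apply: (le_trans (dP _)).
rewrite powRM ?powR_ge0// /g /e.
rewrite -!powRrM mulVf// !powRr1 ?(ltW gam0)//.
have -> // : gam * d * (`|z - xd| / gam) = d * `|z - xd|.
by field; rewrite gt_eqF.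
Qed.

Let bregman_lower z : D z -> dom Th z ->
  (`|z - xd| / gam) `^ p <= fine (Th z) - fine (Th xd) - xid (z - xd).
Proof.
have p0 : 0 < p by apply: lt_trans p1.
by apply: bregman_constant_restrict.
Qed.

(** The initial guess: minimality of [x0] bounds the Bregman distance to [xd] by
    the duality pairing of [xi0 - xid] with [x0 - xd]. *)
Lemma start_bound : `|x0 - xd| <= gam * (g * e).
Proof.
have [Dx0 dx0] : (D `&` dom Th) x0 by rewrite -dom_restrict; exact: dom_start.
have := x0min xd; rewrite !restrictE// (proper_fineK pTh dx0).
rewrite (proper_fineK pTh dxd.1) -!EFinB lee_fin => h.
have t0 : 0 <= `|x0 - xd| / gam by rewrite divr_ge0// ltW.
have ge0 : 0 <= g * e by rewrite mulr_ge0 ?powR_ge0.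
rewrite -ler_pdivrMl// mulrC.
rewrite -[leRHS]add0r -(mulr0 q); apply: (@le_of_powR_le _ p) => //.
rewrite powR0 ?add0r; last by rewrite gt_eqF//; apply: lt_trans p1.
apply: le_trans (xi_le x0); apply: (le_trans (bregman_lower _ Dx0 dx0)).
by move: h; rewrite !linearB/=; lra.
Qed.

Variables (al : R) (F : X -> Y) (F' : X -> bounded_linear X Y) (yd : Y).
Variables (x u : X).
Hypothesis al0 : 0 < al.
Hypothesis umin : minimizers (linearized_functional p al (restrict_to D Th)
  xi0 x0 F F' yd x) u.

Let a := al `^ p^-1.
Let b := `|yd - F x - F' x (xd - x)|.
Let r := `|yd - F x - F' x (u - x)|.

(** One step of the method: comparing the minimizer [u] with [xd], where [b] is
    the linearized residual at [xd] and [r] the one at [u].  The factor [g * e] is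
    the size of the error caused by the choice of [xi0]. *)
Lemma newton_step_bounds :
  [/\ D u, `|u - xd| <= gam * (q * (b / a) + g * e) & r <= b + a * (g * e)].
Proof.
have p0 : 0 < p by apply: lt_trans p1.
have dx0 := dom_start.
have := umin xd.
rewrite /linearized_functional (bregman_fine _ _ xd)// -EFinM -EFinD => h.
have du : dom (restrict_to D Th) u.
  have [//|ndu] := pselect (dom (restrict_to D Th) u).
  by move: h; rewrite bregman_pinfty// gt0_muley ?lte_fin// addey.
have [Du dTu] : (D `&` dom Th) u by rewrite -dom_restrict.
move: h; rewrite (bregman_fine _ _ u)// -EFinM -EFinD lee_fin -/b -/r.
rewrite (restrictE _ _ u)// (restrictE _ _ xd)//.
set f0 := fine (restrict_to D Th x0); rewrite !linearB/= => h.
have lowu := bregman_lower _ Du dTu.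
set dl := fine (Th u) - fine (Th xd) - xid (u - xd) in lowu.
set t := `|u - xd| / gam in lowu.
have t0 : 0 <= t by rewrite divr_ge0// ltW.
have ge0 : 0 <= g * e by rewrite mulr_ge0 ?powR_ge0.
have b0 : 0 <= b by rewrite /b.
have r0 : 0 <= r by rewrite /r.
have a0 : 0 < a by rewrite powR_gt0.
have aal : a `^ p = al by rewrite powRVK ?gt_eqF// ltW.
have main : r `^ p + al * dl <= b `^ p + al * ((g * e) `^ (p - 1) * t).
  have := ler_wpM2l (ltW al0) (xi_le u); rewrite -/t.
  move: h; rewrite /dl !linearB/=; lra.
split=> //; last first.
  exact: (le_residual_of_powR_le _ _ _ _ _ _ _ _ _ p1 pq (ltW a0) aal b0 ge0 t0 r0
    lowu main).
have tle : t <= q * (b / a) + g * e.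
  apply: (@le_of_powR_le _ p) => //; first by rewrite divr_ge0// ltW.
  rewrite (@powRM _ b a^-1) ?invr_ge0 ?(ltW a0)//.
  have -> : a^-1 `^ p = al^-1.
    by rewrite -powR_inv1 ?(ltW a0)// powRAC aal powR_inv1// ltW.
  apply: (le_trans lowu); rewrite -(ler_pM2l al0) [in leRHS]mulrDr (mulrC (b `^ p)).
  rewrite mulVKf ?gt_eqF//; apply: le_trans main.
  by rewrite lerDr powR_ge0.
by rewrite mulrC -ler_pdivrMr.
Qed.

End NewtonStep.

Arguments newton_step_bounds {R X Y p q gam Th D xd x0 xi0 xid} p1 pq gam0 pTh
  lscTh cTh bTh cD Dxd dxd sxid x0min {al F F' yd x u}.
Arguments start_bound {R X p q gam Th D xd x0 xi0 xid}.
Arguments dom_start {R X Th D xd x0 xi0}.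

(** * Propagation of the estimates *)

Section StepEstimates.
Context {R : realType} {X Y : normedModType R}.
Variables (F : X -> Y) (F' : X -> bounded_linear X Y) (D : set X) (xd : X).
Variables (rho K0 K1 : R).
Hypotheses (cD : @convex_set R X D) (gF : gateaux_on F F' D (ball xd rho)).
Hypotheses (K00 : 0 <= K0) (K10 : 0 <= K1).
Hypothesis dF : derivative_condition F' D (ball xd rho) K0 K1.
Hypothesis Bxd : (ball xd rho `&` D) xd.

Let rem x z : (ball xd rho `&` D) x -> (ball xd rho `&` D) z ->
  `|F z - F x - F' x (z - x)| <= (K0 + K1) * `|z - x| * `|F' x (z - x)|.
Proof.
move=> Bx Bz; apply: (newton_remainder _ _ _ _ _ _ _ _ gF dF) => // t t01.
apply: (segment_ball_convex _ _ _ _ _ _ cD Bx Bz t01).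
Qed.

(* [r] is the radius of the region containing the iterates, [E] the scale of the
   images [F' xd (x - xd)], and [eta] bounds [(K0 + K1) * r]; it is small enough
   for all quadratic errors to be absorbed in the slack [s]. *)
Variables (eta s mu g N E r delta : R) (yd : Y).
Hypotheses (s1 : s <= 1) (smu : s <= mu) (g0 : 0 <= g) (N0 : 0 <= N).
Hypotheses (E0 : 0 <= E) (eta0 : 0 <= eta) (mu0 : 0 <= mu).
Hypothesis etaA : eta * (1 + N + mu + g) <= s / 20.
Hypothesis Kr : (K0 + K1) * r <= eta.
Hypothesis yd_delta : `|yd - F xd| <= delta.

Let etas : [/\ 0 <= s, eta <= s / 20, eta * N * E <= s / 20 * E,
  eta * mu * E <= s / 20 * E & eta * g * E <= s / 20 * E].
Proof.
have etaN : 0 <= eta * N by exact: mulr_ge0.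
have etamu : 0 <= eta * mu by exact: mulr_ge0.
have etag : 0 <= eta * g by exact: mulr_ge0.
have etaA' := etaA; have eta0' := eta0.
by split; [lra|lra|apply: ler_wpM2r => //; lra..].
Qed.

Let etaE : eta * E <= s / 20 * E.
Proof. by case: etas => _ h _ _ _; apply: ler_wpM2r. Qed.

Lemma residual_start x : (ball xd rho `&` D) x -> `|x - xd| <= r ->
  `|F' xd (x - xd)| <= g * E -> `|F x - yd| <= delta + (g + s) * E.
Proof.
move=> Bx xr Tx; have [s0 es _ _ eg] := etas.
have := rem _ _ Bxd Bx.
set T := `|F' xd _| in Tx *; set rm := `|_ - F' xd _| => h.
have T0 : 0 <= T by rewrite /T.
have kr : (K0 + K1) * `|x - xd| * T <= eta * T.
  apply: ler_wpM2r => //; apply: le_trans Kr; apply: ler_wpM2l => //.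
  exact: addr_ge0.
have eT := ler_wpM2l eta0 Tx.
have : `|F x - yd| <= rm + T + `|yd - F xd|.
  have -> : F x - yd = (F x - F xd) - (yd - F xd) by rewrite opprB addrA subrK.
  apply: (le_trans (ler_normB _ _)); rewrite lerD2r /rm /T.
  by apply: le_trans (ler_normD _ _); rewrite subrK.
have := mulr_ge0 s0 E0; have := yd_delta; lra.
Qed.

Section Step.
Variables x : X.
Hypotheses (Bx : (ball xd rho `&` D) x) (xr : `|x - xd| <= r).
Hypotheses (Tx : `|F' xd (x - xd)| <= N * E) (deltaE : delta <= mu * E).

Let krE (v : X) : `|v| <= r -> (K0 + K1) * `|v| <= eta.
Proof.
move=> vr; apply: le_trans Kr; apply: ler_wpM2l => //; exact: addr_ge0.
Qed.

Let Fr : `|F' x (x - xd)| <= N * E + s / 20 * E.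
Proof.
have [s0 es eN _ _] := etas.
have h := dF _ _ (x - xd) Bxd Bx.
have tri : `|F' x (x - xd)| <= `|F' x (x - xd) - F' xd (x - xd)| + `|F' xd (x - xd)|.
  by apply: le_trans (ler_normD _ _); rewrite subrK.
move: h tri Tx; set T := `|F' xd _|; set nr := `|x - xd| => h tri Tx'.
have T0 : 0 <= T by rewrite /T.
have := ler_wpM2r T0 (krE _ xr); rewrite -/nr => h2.
have := ler_wpM2l eta0 Tx'; lra.
Qed.

Lemma linearization_at_solution : `|yd - F x - F' x (xd - x)| <= delta + s / 10 * E.
Proof.
have [s0 es eN _ _] := etas.
have h := rem _ _ Bx Bxd.
have FrE : `|F' x (xd - x)| <= N * E + s / 20 * E.
  by rewrite -opprB linearN normrN.
have xr' : `|xd - x| <= r by rewrite distrC.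
have k := ler_wpM2r (normr_ge0 (F' x (xd - x))) (krE _ xr').
have k2 := ler_wpM2l eta0 FrE.
have dE := yd_delta; have s1' := s1; have sE0 := mulr_ge0 s0 E0; have eE := etaE.
have tri : `|yd - F x - F' x (xd - x)| <=
    `|yd - F xd| + `|F xd - F x - F' x (xd - x)|.
  by apply: le_trans (ler_normD _ _); rewrite !addrA subrK.
have e1 : eta * (s / 20 * E) <= 1 * (s / 20 * E).
  by apply: ler_wpM2r; lra.
lra.
Qed.

Variable u : X.
Hypotheses (Bu : (ball xd rho `&` D) u) (ur : `|u - xd| <= r).
Hypothesis res : `|yd - F x - F' x (u - x)| <=
  `|yd - F x - F' x (xd - x)| + g * E.

Let Fw : `|F' x (u - xd)| <= 2 * delta + s / 5 * E + g * E.
Proof.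
have b := linearization_at_solution; have res' := res.
have : `|F' x (u - xd)| <= `|yd - F x - F' x (xd - x)| + `|yd - F x - F' x (u - x)|.
  apply: le_trans (ler_normB _ _).
  set c := yd - F x.
  have -> // : c - F' x (xd - x) - (c - F' x (u - x)) = F' x (u - xd).
  by rewrite opprB addrC addrA subrK -linearB opprB addrA subrK.
lra.
Qed.

(** The bound holds for [F' x] up to the slack, by subtracting the two linearized
    residuals; the nonlinearity condition carries it over to [F' xd]. *)
Lemma derivative_bound_step : `|F' xd (u - xd)| <= (3 * mu + g) * E.
Proof.
have [s0 es eN em eg] := etas.
have h := dF _ _ (u - xd) Bxd Bx.
have tri : `|F' xd (u - xd)| <= `|F' x (u - xd) - F' xd (u - xd)| + `|F' x (u - xd)|.
  by rewrite distrC; apply: le_trans (ler_normD _ _); rewrite subrK.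
move: h tri Tx Fw; set Tw := `|F' xd (u - xd)|; set T := `|F' xd _|.
set nr := `|x - xd|; set nw := `|u - xd| => h tri Tx' Fw'.
have nr0 : 0 <= nr by rewrite /nr.
have nw0 : 0 <= nw by rewrite /nw.
have Tw0 : 0 <= Tw by rewrite /Tw.
have T0 : 0 <= T by rewrite /T.
have k1 : K0 * nr * Tw <= eta * Tw.
  apply: ler_wpM2r => //; apply: le_trans (krE _ xr).
  by rewrite -/nr ler_wpM2r// lerDl.
have k2 : K1 * T * nw <= eta * (N * E).
  rewrite mulrAC; apply: ler_pM => //; first exact: mulr_ge0.
  apply: le_trans (krE _ ur).
  by rewrite -/nw ler_wpM2r// lerDr.
have dE := deltaE; have s1' := s1.
have e1 : 0 < 1 - eta by lra.
rewrite -(ler_pM2l e1).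
have sE : s * E <= mu * E by apply: ler_wpM2r.
have sE0 := mulr_ge0 s0 E0.
lra.
Qed.

Lemma residual_step : `|F u - yd| <= delta + (g + s) * E.
Proof.
have [s0 es eN em eg] := etas.
have b := linearization_at_solution; have res' := res; have dE := deltaE.
have eE := etaE; have h := rem _ _ Bx Bu.
have tri : `|F u - yd| <= `|F u - F x - F' x (u - x)| + `|yd - F x - F' x (u - x)|.
  apply: le_trans (ler_normB _ _).
  by rewrite opprB addrA subrK opprB addrA subrK.
have uxE : u - x = (u - xd) - (x - xd) by rewrite opprB addrA subrK.
have Fux : `|F' x (u - x)| <= `|F' x (u - xd)| + `|F' x (x - xd)|.
  by rewrite {1}uxE linearB ler_normB.
have k : (K0 + K1) * `|u - x| <= 2 * eta.
  apply: (@le_trans _ _ ((K0 + K1) * (`|u - xd| + `|x - xd|))).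
    by rewrite uxE ler_wpM2l ?addr_ge0// ler_normB.
  have := krE _ ur; have := krE _ xr; lra.
have k2 := ler_wpM2r (normr_ge0 (F' x (u - x))) k.
have Fux' : `|F' x (u - x)| <= 2 * mu * E + s / 5 * E + g * E + (N * E + s / 20 * E).
  have := Fr; have := Fw; lra.
have k3 := ler_wpM2l eta0 Fux'.
have sE0 := mulr_ge0 s0 E0.
have e1 : eta * (s * E) <= 1 * (eta * E).
  by rewrite mulrCA; apply: ler_wpM2r => //; exact: mulr_ge0.
lra.
Qed.

End Step.
End StepEstimates.

Arguments residual_start {R X Y F F' D xd rho K0 K1} cD gF K00 K10 dF Bxd
  {eta s mu g N E r delta yd}.
Arguments linearization_at_solution {R X Y F F' D xd rho K0 K1} cD gF K00 K10
  dF Bxd {eta s mu g N E r delta yd} s1 g0 N0 E0 eta0 mu0 etaA Kr yd_delta {x}.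
Arguments derivative_bound_step {R X Y F F' D xd rho K0 K1} cD gF K00 K10
  dF Bxd {eta s mu g N E r delta yd} s1 smu g0 N0 E0 eta0 mu0 etaA Kr yd_delta {x}
  Bx xr Tx deltaE {u}.
Arguments residual_step {R X Y F F' D xd rho K0 K1} cD gF K00 K10
  dF Bxd {eta s mu g N E r delta yd} s1 g0 N0 E0 eta0 mu0 etaA Kr yd_delta {x}
  Bx xr Tx deltaE {u}.

(** * Stopping indices *)

Section StoppingRules.
Context {R : realType}.

Lemma first_from_exists (m N : nat) (P : nat -> Prop) : (m <= N)%N -> P N ->
  (exists n, first_from m P n) /\ forall n, first_from m P n -> (n <= N)%N.
Proof.
move=> mN PN; split; last first.
  by move=> n [_ _ nP]; rewrite leqNgt; apply/negP => Nn; apply: (nP N); rewrite ?mN.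
have ex : exists n, (m <= n)%N && `[< P n >] by exists N; rewrite mN; apply/asboolP.
case: (ex_minnP ex) => n /andP[mn /asboolP Pn] nmin; exists n.
split=> // k /andP[mk kn] Pk.
have := nmin k; rewrite mk asboolT// => /(_ isT).
by rewrite leqNgt kn.
Qed.

(** All three rules stop in time as soon as the residual is below the threshold
    at [N] and, if [N] is positive, at [N - 1]. *)
Lemma rules_stop (r : nat -> R) (c : R) (N : nat)
    (rule : (nat -> R) -> R -> nat -> Prop) :
  (forall n, (n <= N <= n.+1)%N -> r n <= c) ->
  [\/ rule = @rule1 R, rule = @rule2 R | rule = @rule3 R] ->
  (exists n, rule r c n) /\ forall n, rule r c n -> (n <= N)%N.
Proof.
move=> rc rE.
have rN : r N <= c by apply: rc; rewrite leqnn leqnSn.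
have rN1 : r N.-1 <= c by apply: rc; rewrite leq_pred leqSpred.
case: rE => ->.
- have [[n [_ rn nmin]] all] := first_from_exists 0 N (fun n => r n <= c) (leq0n N) rN.
  split.
    exists n; split=> // k kn; rewrite ltNge; apply/negP; exact: nmin.
  move=> k [rk kmin]; apply: all; split=> // j /= jk rj.
  by have := kmin j jk; rewrite ltNge rj.
- rewrite /rule2; case: (boolP (r 0%N <= c)) => [r0|/negP r0].
    by split; [exists 0%N|move=> n ->].
  apply: first_from_exists; last by lra.
  by rewrite lt0n; apply/eqP => N0; apply: r0; rewrite -N0.
- rewrite /rule3; case: (boolP (r 0%N <= c)) => [r0|/negP r0].
    by split; [exists 0%N|move=> n ->].
  apply: first_from_exists; last by rewrite ge_max rN.
  by rewrite leqNgt; apply/negP => N1; apply: r0; apply: rc.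
Qed.

End StoppingRules.

Section Scales.
Context {R : realType}.

(** The index [nhat] compares [delta] with the scale [d `^ (p-1)^-1] of the
    error times the [p]-th roots of the regularization parameters.  Its defining
    inequality forces [d > 0], as division by zero gives zero. *)
Lemma a_priori_index_root (alpha : nat -> R) (p q mu delta d : R) (N : nat) :
  1 < p -> p^-1 + q^-1 = 1 -> 0 < mu -> 0 < delta -> 0 <= d ->
  (forall n, 0 < alpha n) ->
  a_priori_index alpha (mu `^ (- p) * delta `^ p / d `^ q) N ->
  let e := d `^ (p - 1)^-1 in
  [/\ 0 < e, mu * e * alpha N `^ p^-1 <= delta &
    forall n, (n < N)%N -> delta <= mu * e * alpha n `^ p^-1].
Proof.
move=> p1 pq mu0 delta0 d0 al0 [alN alle] e.
have p0 : 0 < p by lra.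
have qE := conjugate_exponent _ _ p1 pq.
have q0 : 0 < q by rewrite qE divr_gt0// subr_gt0.
have d_gt0 : 0 < d.
  rewrite lt_neqAle d0 andbT; apply/eqP => d0'; move: alN.
  by rewrite -d0' powR0 ?gt_eqF// invr0 mulr0 leNgt al0.
have e0 : 0 < e by rewrite powR_gt0.
have me0 : 0 < mu * e by rewrite mulr_gt0.
have cE : mu `^ (- p) * delta `^ p / d `^ q = (delta / (mu * e)) `^ p.
  rewrite [RHS]powRM ?invr_ge0 ?(ltW delta0) ?(ltW me0)//.
  have -> : (mu * e)^-1 `^ p = (mu `^ p)^-1 * (d `^ q)^-1.
    rewrite -powR_inv1 ?(ltW me0)// powRAC powR_inv1 ?powR_ge0//.
    rewrite powRM ?(ltW mu0) ?(ltW e0)// invfM; congr (_ * _^-1).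
    by rewrite -powRrM qE (mulrC p).
  by rewrite powRN mulrAC mulrC mulrA.
have dme0 : 0 <= delta / (mu * e) by rewrite divr_ge0// ltW.
split=> // [|n nN].
  rewrite mulrC -ler_pdivlMr//.
  rewrite -[leRHS](@powRKV _ p) ?gt_eqF//.
  apply: ge0_ler_powR; rewrite ?nnegrE ?invr_ge0 ?(ltW p0) ?(ltW (al0 N)) ?powR_ge0//.
  by rewrite -cE.
rewrite mulrC -ler_pdivrMr//.
rewrite -[leLHS](@powRKV _ p) ?gt_eqF//.
apply: ge0_ler_powR; rewrite ?nnegrE ?invr_ge0 ?(ltW p0) ?(ltW (al0 n)) ?powR_ge0//.
by rewrite -cE ltW// alle.
Qed.

End Scales.

(** * Convergence estimates and termination *)

Theorem lemma3p1 (R : realType) (p pstar gam theta tau mu : R)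
    (hp : 2 <= p) (hpstar : p^-1 + pstar^-1 = 1)
    (hgam : 0 < gam) (htheta : 1 < theta) (htau : 1 < tau) (hmu : 0 < mu)
    (hmu_small : gam `^ (p - 1)^-1 * theta `^ (2 / p) * mu^-1 < (tau - 1) / 2) :
  exists eps : R, 0 < eps /\
  forall (X Y : completeNormedModType R)
    (Th : X -> \bar R)
    (hTh_proper : proper_function Th) (hTh_lsc : lower_semicontinuous Th)
    (hTh_pconvex : p_convex p Th) (hTh_gam : bregman_constant p gam Th)
    (alpha : nat -> R)
    (halpha_gt0 : forall n, 0 < alpha n)
    (halpha_ratio : forall n, 1 <= alpha n / alpha n.+1 <= theta)
    (halpha_lim : alpha @ \oo --> 0)
    (D : set X) (F : X -> Y) (F' : X -> bounded_linear X Y)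
    (y : Y) (xd : X) (rho K0 K1 : R)
    (hD_closed : closed D) (hD_convex : @convex_set R X D)
    (hxd : (D `&` dom_subdiff Th) xd) (hFxd : F xd = y)
    (hrho : 0 < rho)
    (hF' : gateaux_on F F' D (ball xd rho))
    (hT : opnorm (F' xd) <= alpha 0%N `^ p^-1 / gam)
    (hK0 : 0 <= K0) (hK1 : 0 <= K1)
    (hK : derivative_condition F' D (ball xd rho) K0 K1)
    (xi0 xid : dual_space X) (x0 : X)
    (hx0 : minimizers (fun x => restrict_to D Th x - (xi0 x)%:E)%E = [set x0])
    (hxid : nearest_subgradients (restrict_to D Th) xd xi0 = [set xid])
    (hxi : xi0 <> xid)
    (delta : R) (yd : Y) (hdelta : 0 < delta) (hyd : `|yd - y| <= delta)
    (x : nat -> X)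
    (hx : iterates p alpha Th F F' D (ball xd rho) xi0 x0 yd x)
    (nhat : nat)
    (hnhat : a_priori_index alpha
       (mu `^ (- p) * delta `^ p / dual_dist xi0 xid `^ pstar) nhat)
    (hball : (pstar * gam * mu + 2 * gam `^ (p / (p - 1)))
             * dual_dist xi0 xid `^ (p - 1)^-1 < rho)
    (hE : (K0 + K1) * dual_dist xi0 xid `^ (p - 1)^-1 < eps),
  (forall n, (n <= nhat)%N ->
     [/\ (ball xd rho `&` D) (x n),
         `|x n - xd| <= (pstar * gam * mu + 2 * gam `^ (p / (p - 1)))
                        * dual_dist xi0 xid `^ (p - 1)^-1 &
         `|F' xd (x n - xd)| <= (3 * mu + gam `^ (p - 1)^-1) * theta `^ p^-1
                        * dual_dist xi0 xid `^ (p - 1)^-1 * alpha n `^ p^-1]) /\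
  (forall rule : (nat -> R) -> R -> nat -> Prop,
     [\/ rule = @rule1 R, rule = @rule2 R | rule = @rule3 R] ->
     let stops := rule (fun n => `|F (x n) - yd|) (tau * delta) in
     (exists ndelta, stops ndelta) /\
     (forall ndelta, stops ndelta -> (ndelta <= nhat)%N)).
Proof.
have p1 : 1 < p by lra.
have p0 : 0 < p by lra.
have qE := conjugate_exponent _ _ p1 hpstar.
set q := pstar in hpstar qE *.
have q0 : 0 < q by rewrite qE divr_gt0// subr_gt0.
set g := gam `^ (p - 1)^-1 in hmu_small *.
have g0 : 0 < g by rewrite powR_gt0.
set th := theta `^ p^-1.
have th1 : 1 <= th.
  rewrite -(powRr0 theta); apply: ler_powR; first exact: ltW.
  by rewrite invr_ge0 ltW.
have th2E : theta `^ (2 / p) = th ^+ 2.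
  by rewrite mulrC powRrM -powR_mulrn// powR_ge0.
rewrite th2E in hmu_small.
have th20 : 0 < th ^+ 2 by rewrite exprn_gt0//; lra.
have gamgE : gam `^ (p / (p - 1)) = gam * g.
  have -> : p / (p - 1) = 1 + (p - 1)^-1 by field; rewrite subr_eq0 gt_eqF.
  by rewrite powRD ?powRr1 ?(ltW hgam)// (gt_eqF hgam) implybT.
rewrite gamgE.
set M := q * gam * mu + 2 * (gam * g).
have M0 : 0 < M by rewrite addr_gt0 ?mulr_gt0.
set N := (3 * mu + g) * th.
have mug0 : 0 < 3 * mu + g by rewrite addr_gt0 ?mulr_gt0.
have N0 : 0 < N by rewrite mulr_gt0//; lra.
pose A := 1 + N + mu + g.
have A0 : 0 < A by rewrite /A; lra.
(* the slack: below [mu] for the bound on [F' xd], below [g / q] for the radius of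
   the ball, and below the gap left by the choice of [mu] for the residuals *)
pose s := Num.min (Num.min 1 mu) (Num.min (g / q) ((tau - 1) / 2 * mu / th ^+ 2)).
have tau0 : 0 < (tau - 1) / 2 by lra.
have s0 : 0 < s by rewrite !lt_min ltr01 hmu !divr_gt0// mulr_gt0.
have s1 : s <= 1 by rewrite !ge_min lexx.
have smu : s <= mu by rewrite !ge_min lexx orbT.
have sg : q * s <= g.
  by rewrite mulrC -ler_pdivlMr// !ge_min lexx !orbT.
have stau : s * th ^+ 2 <= (tau - 1) / 2 * mu.
  by rewrite -ler_pdivlMr// !ge_min lexx !orbT.
have gtau : g * th ^+ 2 <= (tau - 1) / 2 * mu by rewrite -ler_pdivrMr// ltW.
pose eta := s / (20 * A).
have eta0 : 0 < eta by rewrite divr_gt0// mulr_gt0.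
have etaA : eta * (1 + N + mu + g) <= s / 20.
  rewrite -/A /eta; have -> // : s / (20 * A) * A = s / 20.
  by field; rewrite gt_eqF.
(* the threshold gives [(K0 + K1) * (M * e) <= eta], with [M * e] the radius *)
exists (eta / M); split; first by rewrite divr_gt0.
move=> X Y Th hTh_proper hTh_lsc hTh_pconvex hTh_gam alpha al0 al_ratio _.
move=> D F F' y xd rho K0 K1 _ cD [Dxd dxd] hFxd rho0 gF hT K00 K10 dF.
move=> xi0 xid x0 hx0 hxid _ delta yd delta0 hyd x [x0E xS] nhat hnhat hball hE.
have [d0 _] := dual_dist_bounds xi0 xid.
have [e0 anhat alt] :=
  a_priori_index_root _ _ _ _ _ _ _ p1 hpstar hmu delta0 d0 al0 hnhat.
set e := dual_dist xi0 xid `^ (p - 1)^-1 in hball hE e0 anhat alt *.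
pose a n := alpha n `^ p^-1.
have a0 n : 0 < a n by rewrite powR_gt0.
have aS n : a n <= th * a n.+1.
  rewrite /a /th -powRM ?(ltW (al0 _))//; last by lra.
  apply: ge0_ler_powR; rewrite ?nnegrE ?invr_ge0 ?(ltW p0) ?(ltW (al0 _))//.
    by rewrite mulr_ge0 ?(ltW (al0 _))//; lra.
  by rewrite -ler_pdivrMr//; case/andP: (al_ratio n).
have Me0 : 0 < M * e by rewrite mulr_gt0.
have KM : (K0 + K1) * (M * e) <= eta.
  rewrite (mulrC M) mulrA -ler_pdivlMr//; exact: ltW.
have Bxd : (ball xd rho `&` D) xd by split=> //; exact: ballxx.
have inball z : D z -> `|z - xd| <= M * e -> (ball xd rho `&` D) z.
  move=> Dz zr; split=> //; rewrite -ball_normE /= distrC.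
  exact: le_lt_trans zr hball.
have sxid : subdiff (restrict_to D Th) xd xid.
  have : nearest_subgradients (restrict_to D Th) xd xi0 xid by rewrite hxid.
  by case.
have x0min : minimizers (fun x => restrict_to D Th x - (xi0 x)%:E)%E x0.
  by rewrite hx0.
have ydF : `|yd - F xd| <= delta by rewrite hFxd.
pose good n := [/\ (ball xd rho `&` D) (x n), `|x n - xd| <= M * e
  & `|F' xd (x n - xd)| <= N * (e * a n)].
have start : good 0%N /\ `|F (x 0%N) - yd| <= delta + (g + s) * (e * a 0%N).
  have [Dx0 dx0] : (D `&` dom Th) x0.
    by rewrite -dom_restrict; exact: (dom_start hTh_proper Dxd dxd x0min).
  have x0r : `|x0 - xd| <= gam * (g * e).
    exact: (start_bound p1 hpstar hgam hTh_proper hTh_lsc hTh_pconvex hTh_gam cD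
      Dxd dxd sxid x0min).
  have x0M : `|x0 - xd| <= M * e.
    apply: (le_trans x0r); rewrite mulrA ler_wpM2r ?(ltW e0)// /M.
    have : 0 < q * gam * mu by rewrite !mulr_gt0.
    have : 0 < gam * g by rewrite mulr_gt0.
    lra.
  have Tx0 : `|F' xd (x0 - xd)| <= g * (e * a 0%N).
    apply: (le_trans (le_opnorm _ _)).
    apply: (@le_trans _ _ (a 0%N / gam * (gam * (g * e)))).
      exact: (ler_pM (opnorm_ge0 _) (normr_ge0 _) hT x0r).
    have -> // : a 0%N / gam * (gam * (g * e)) = g * (e * a 0%N).
    by field; rewrite gt_eqF.
  rewrite x0E; have B0 := inball _ Dx0 x0M.
  have ea0 : 0 <= e * a 0%N by rewrite mulr_ge0 ?(ltW e0) ?(ltW (a0 _)).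
  split.
    rewrite /good x0E; split=> //; apply: (le_trans Tx0); rewrite ler_wpM2r//.
    by rewrite /N -[g]mulr1 ler_pM ?(ltW g0)// mulr1 lerDr mulr_ge0 ?(ltW hmu).
  exact: (residual_start cD gF K00 K10 dF Bxd (ltW g0) (ltW N0) ea0 (ltW eta0)
    (ltW hmu) etaA KM ydF).
have step n : (n < nhat)%N -> good n ->
    good n.+1 /\ `|F (x n.+1) - yd| <= delta + (g + s) * (e * a n).
  move=> nnhat [Bx xr Tx].
  have umin : minimizers (linearized_functional p (alpha n) (restrict_to D Th)
      xi0 x0 F F' yd (x n)) (x n.+1) by rewrite xS.
  have ea0 : 0 <= e * a n by rewrite mulr_ge0 ?(ltW e0) ?(ltW (a0 _)).
  have deltaE : delta <= mu * (e * a n) by rewrite mulrA; exact: alt.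
  have [Du ur res] := newton_step_bounds p1 hpstar hgam
    hTh_proper hTh_lsc hTh_pconvex hTh_gam cD Dxd dxd sxid x0min
    (al0 n) umin.
  rewrite -/g -/e -/(a n) in ur res.
  have b := linearization_at_solution cD gF K00 K10 dF Bxd s1 (ltW g0) (ltW N0) ea0
    (ltW eta0) (ltW hmu) etaA KM ydF Bx xr Tx.
  have ur' : `|x n.+1 - xd| <= M * e.
    apply: (le_trans ur).
    have ba : `|yd - F (x n) - F' (x n) (xd - x n)| / a n <= (mu + s / 10) * e.
      rewrite ler_pdivrMr//; apply: (le_trans b).
      by rewrite mulrDl mulrDl -!mulrA lerD2r.
    have sgl : q * (s / 10) <= g by rewrite mulrA; lra.
    rewrite /M [X in _ <= X * e](_ : _ = gam * (q * mu + 2 * g)); last by ring.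
    rewrite -[leRHS]mulrA ler_pM2l//.
    apply: (@le_trans _ _ (q * ((mu + s / 10) * e) + g * e)).
      by rewrite lerD2r ler_pM2l.
    by rewrite mulrA -mulrDl ler_pM2r// mulrDr; lra.
  have Bu := inball _ Du ur'.
  rewrite (mulrCA (a n)) (mulrC (a n)) in res.
  have res' : `|yd - F (x n) - F' (x n) (x n.+1 - x n)| <=
      `|yd - F (x n) - F' (x n) (xd - x n)| + g * (e * a n) := res.
  split; last first.
    exact: (residual_step cD gF K00 K10 dF Bxd s1 (ltW g0) (ltW N0) ea0
      (ltW eta0) (ltW hmu) etaA KM ydF Bx xr Tx deltaE Bu ur' res').
  split=> //.
  apply: (le_trans (derivative_bound_step cD gF K00 K10 dF Bxd s1 smu (ltW g0)
    (ltW N0) ea0 (ltW eta0) (ltW hmu) etaA KM ydF Bx xr Tx deltaE ur' res')).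
  rewrite /N -[leRHS]mulrA ler_pM2l// mulrCA ler_pM2l//; exact: aS.
have all_good n : (n <= nhat)%N -> good n.
  elim: n => [_|n IHn nn]; first by case: start.
  by case: (step n nn (IHn (ltnW nn))).
split=> [n /all_good[Bx xr Tx]|rule ruleE stops].
  by split=> //; apply: (le_trans Tx); rewrite /N !mulrA.
apply: rules_stop => // n /andP[nn nn1].
(* for [n = 0] the predecessor is [0] again, and the bound is that of the start *)
have res : `|F (x n) - yd| <= delta + (g + s) * (e * a n.-1).
  case: n nn nn1 => [_ _|n nn _]; first by case: start.
  by case: (step n nn (all_good n (ltnW nn))).
apply: (le_trans res).
have th0 : 0 <= th by lra.
have a2 m : a m <= th ^+ 2 * a m.+2.
  apply: (le_trans (aS m)); rewrite expr2 -mulrA.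
  by apply: ler_wpM2l => //; exact: aS.
have th2 : 1 <= th ^+ 2 by rewrite exprn_ege1.
have thth2 : th <= th ^+ 2 by rewrite expr2 ler_peMl.
(* at most two steps lead from [n.-1] to [nhat] *)
have an : a n.-1 <= th ^+ 2 * a nhat.
  have [->|n_lt] := eqVneq n nhat.
    case: (nhat) => [|m] /=; first by rewrite ler_peMl// ltW.
    by apply: (le_trans (aS m)); rewrite ler_wpM2r// ltW.
  have {nn1} -> : nhat = n.+1.
    by apply/eqP; rewrite eqn_leq nn1 ltn_neqAle n_lt nn.
  case: n {nn n_lt res} => [|n] /=; last exact: a2.
  by apply: (le_trans (aS 0%N)); rewrite ler_wpM2r// ltW.
have ean : e * a n.-1 <= th ^+ 2 * (e * a nhat).
  by rewrite mulrCA ler_pM2l.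
have gs0 : 0 <= g + s by lra.
have h1 := ler_wpM2l gs0 ean.
have gsth : (g + s) * th ^+ 2 <= (tau - 1) * mu by rewrite mulrDl; lra.
have eanh0 : 0 <= e * a nhat by rewrite mulr_ge0 ?(ltW e0) ?(ltW (a0 _)).
have h2 := ler_wpM2r eanh0 gsth.
have tau1 : 0 <= tau - 1 by lra.
have h3 := ler_wpM2l tau1 anhat.
rewrite -/(a nhat) in h3.
have -> : tau * delta = delta + (tau - 1) * delta by ring.
rewrite lerD2l.
apply: (le_trans h1); rewrite (mulrA (g + s)); apply: (le_trans h2).
by move: h3; rewrite !mulrA.
Qed.
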